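(* Let $\mathcal{Y}$ be a measurable space and $\{Y_t\}_{t\ge 0}$ a Markov chain on $\mathcal{Y}$ with transition kernel $P$ ($P^n$ the $n$-step kernel) satisfying the standing assumptions (A1)–(A3) below. Let $H:\mathbb{R}^d\times\mathcal{Y}\to\mathbb{R}^d$, $h(w)\doteq\mathbb{E}_{y\sim d_{\mathcal{Y}}}[H(w,y)]$, and let $w_*$ be the unique fixed point of $h$. Let $w_0\in\mathbb{R}^d$ and define iterates $$w_{t+1}=w_t+\alpha_t\big(H(w_t,Y_{t+1})-w_t\big),\qquad t\ge 0,$$ with learning rates $\alpha_t=\frac{C_\alpha}{(t+3)^{\nu}}$ for some constant $C_\alpha>0$ and some $\nu\in(\frac{2}{3},1]$. Then: (i) if $\nu<1$, then for any $\zeta\in(0,\frac{3}{2}\nu-1)$, $\lim_{t\to\infty}t^{\zeta}\|w_t-w_*\|^2=0$ almost surely; (ii) if $\nu=1$, then for any $\zeta\in(0,1)$ and any $\nu_1>0$, $\lim_{t\to\infty}\exp\big(\zeta\ln^{1/(1+\nu_1)}t\big)\|w_t-w_*\|^2=0$ almost surely.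
   Context: Standing assumptions. (A1) Geometric mixing: $\{Y_t\}$ has a unique stationary distribution $d_{\mathcal{Y}}$ and there exist constants $\varrho\in[0,1)$ and $C_{A}$ such that for all $y\in\mathcal{Y}$ and all $n\ge 0$, $\int_{\mathcal{Y}}|P^n(y,y')-d_{\mathcal{Y}}(y')|\,\mathrm{d}y'\le C_A\varrho^n$ (i.e. the total variation distance between $P^n(y,\cdot)$ and $d_{\mathcal{Y}}$ decays geometrically, uniformly in $y$). (A2) Contraction: there exist $\kappa\in[0,1)$ and a norm $\|\cdot\|$ on $\mathbb{R}^d$ such that $\|h(w)-h(w')\|\le\kappa\|w-w'\|$ for all $w,w'$ (so $h$ has a unique fixed point $w_*$). (A3) Lipschitz: there exists a finite $L_h$ with $\|H(w,y)-H(w',y)\|\le L_h\|w-w'\|$ for all $w,w'\in\mathbb{R}^d$, $y\in\mathcal{Y}$, and $\sup_{y\in\mathcal{Y}}\|H(0,y)\|<\infty$. The norm $\|\cdot\|$ in the conclusion is the norm of (A2). *)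

(* Defs.v *)
From HB Require Import structures.
From mathcomp Require Import all_boot all_order all_algebra.
From mathcomp Require Import all_classical all_reals all_analysis.
Set Implicit Arguments. Unset Strict Implicit. Unset Printing Implicit Defensive.
Import Order.TTheory GRing.Theory Num.Theory.
Local Open Scope classical_set_scope.
Local Open Scope ring_scope.

Definition is_norm (R : realType) (d : nat) (nrm : 'rV[R]_d -> R) : Prop :=
  [/\ forall x, 0 <= nrm x,
      forall x, nrm x = 0 -> x = 0,
      forall (a : R) x, nrm (a *: x) = `|a| * nrm x
    & forall x y, nrm (x + y) <= nrm x + nrm y].

Fixpoint kiter (R : realType) (dY : measure_display) (Y : measurableType dY)
  (P : R.-pker Y ~> Y) (n : nat) : Y -> set Y -> \bar R :=
  match n with
  | 0 => fun y A => \d_y A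
  | n'.+1 => fun y A => (\int[P y]_z kiter P n' z A)%E
  end.

Definition stationary (R : realType) (dY : measure_display) (Y : measurableType dY)
  (P : R.-pker Y ~> Y) (mu : probability Y R) : Prop :=
  forall A, measurable A -> mu A = (\int[mu]_y P y A)%E.

Definition nat_filtration (dO : measure_display) (Omega : measurableType dO)
  (dY : measure_display) (Y : measurableType dY) (X : nat -> Omega -> Y)
  (t : nat) : set (set Omega) :=
  <<s [set B | exists s A, (s <= t)%N /\ measurable A /\ B = X s @^-1` A] >>.

(** X is a Markov chain with transition kernel P on (Omega, Prob):
    each X_t is measurable and P(X_{t+1} in A | F_t) = P(X_t, A),
    i.e. Prob(B /\ X_{t+1} in A) = \int_B P(X_t(w), A) dProb(w) for B in F_t. *)
Definition markov_chain (R : realType) (dO : measure_display)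
  (Omega : measurableType dO) (Prob : probability Omega R)
  (dY : measure_display) (Y : measurableType dY) (P : R.-pker Y ~> Y)
  (X : nat -> Omega -> Y) : Prop :=
  (forall t, measurable_fun setT (X t)) /\
  forall t B A, nat_filtration X t B -> measurable A ->
    Prob (B `&` X t.+1 @^-1` A) = (\int[Prob]_(w in B) P (X t w) A)%E.

Definition mean_field (R : realType) (d : nat) (dY : measure_display)
  (Y : measurableType dY) (mu : probability Y R) (H : 'rV[R]_d -> Y -> 'rV[R]_d)
  (w : 'rV[R]_d) : 'rV[R]_d :=
  \row_i Rintegral mu setT (fun y => H w y 0 i).

Definition lrate (R : realType) (Calpha nu : R) (t : nat) : R :=
  Calpha / ((t + 3)%:R `^ nu).

Fixpoint sa_iter (R : realType) (d : nat) (dY : measure_display)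
  (Y : measurableType dY) (Omega : Type) (H : 'rV[R]_d -> Y -> 'rV[R]_d)
  (X : nat -> Omega -> Y) (alpha : nat -> R) (w0 : 'rV[R]_d) (t : nat)
  (om : Omega) : 'rV[R]_d :=
  match t with
  | 0 => w0
  | t'.+1 => let wt := sa_iter H X alpha w0 t' om in
             wt + alpha t' *: (H wt (X t'.+1 om) - wt)
  end.

(* Main.v *)
Require Import Defs.
From HB Require Import structures.
From mathcomp Require Import all_boot all_order all_algebra.
From mathcomp Require Import all_classical all_reals all_analysis.
From mathcomp Require Import measurable_realfun ring lra.
Set Implicit Arguments. Unset Strict Implicit. Unset Printing Implicit Defensive.
Import Order.TTheory GRing.Theory Num.Theory.
Import numFieldNormedType.Exports.
Local Open Scope classical_set_scope.
Local Open Scope ring_scope.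

(** Let [p] be the fixed point of [h], let [v] be the iteration driven by the mean
    field along the actual iterates, [v_(t+1) = (1 - a_t) v_t + a_t (h(w_t) - p)],
    and [U = w - p - v], so that
    [U_(t+1) = (1 - a_t) U_t + a_t (H(w_t, Y_(t+1)) - h(w_t))].  Since [h] is a
    contraction, [|v_(t+1)| <= (1 - (1 - kappa) a_t) |v_t| + kappa a_t |U_t|] in the
    given norm, whatever that norm is, while [U] can be treated coordinatewise.
    Freezing the iterate [tau ~ log t] steps back and using the uniform mixing,
    the correlation of [U_t] with the new noise is [O(tau a_(t-tau) + rho^tau)]
    times the largest past second moment.  Hence [Phi = E |v|^2 + lam E |U|^2]
    satisfies [Phi_(t+1) <= (1 - c a_t) Phi_t + a_t b_t K max_(r <= t) Phi_r] with
    [b_t = O(t^-q)] for every [q < nu]; this gives first boundedness and then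
    [E |w_t - p|^2 = O(t^-q)] (for [nu = 1], with some small [q > 0]).
    Finally [|w_(t+1) - w_t| = O(a_t (1 + |w_t - p|))], so the increments of
    [g_t = t^zeta |w_t - p|^2] have summable expectations as soon as
    [zeta < nu + q/2 - 1] and [zeta < q]; then [g_t] converges almost surely, and
    its limit is [0] because [E g_t] tends to [0]. *)

(** * Norms on row vectors *)

(** The norm is arbitrary, so its square has no expansion into linear and quadratic terms, while
    averaging out the noise needs one. This forces the splitting of the error: the noise never
    enters [v] directly, where the triangle inequality and convexity suffice; only [U], whose
    coordinates have exact squares, meets the mixing estimate. No conditional expectation is formed.
    The Markov property is an identity of integrals over events of the past, and a random frozen
    iterate is handled by cutting the space into past events on which it is almost constant.
    Integrability is free, because at each fixed time the iterates are bounded by a constant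
    independent of the sample. Letting [q] tend to [nu] in [zeta < nu + q/2 - 1] produces the
    exponent [3/2 nu - 1]. For [nu = 1], [Calpha] and [1 - kappa] limit [q], but any positive power
    of [t] outgrows the exponential of a power below 1 of [ln t]. *)

Section norms.
Context {R : realType} {d : nat} (nrm : 'rV[R]_d -> R) (nrmP : is_norm nrm).

Lemma nrm_ge0 x : 0 <= nrm x. Proof. by case: nrmP. Qed.
Lemma nrmZ a x : nrm (a *: x) = `|a| * nrm x. Proof. by case: nrmP. Qed.
Lemma ler_nrmD x y : nrm (x + y) <= nrm x + nrm y. Proof. by case: nrmP. Qed.
Lemma nrm_eq0 x : nrm x = 0 -> x = 0. Proof. by case: nrmP => _ /(_ x). Qed.

Lemma nrm0 : nrm 0 = 0.
Proof. by rewrite -(scale0r 0) nrmZ normr0 mul0r. Qed.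

Lemma nrmN x : nrm (- x) = nrm x.
Proof. by rewrite -scaleN1r nrmZ normrN1 mul1r. Qed.

Lemma nrm_distC x y : nrm (x - y) = nrm (y - x).
Proof. by rewrite -nrmN opprB. Qed.

Lemma ler_nrm_dist x y : `|nrm x - nrm y| <= nrm (x - y).
Proof.
have h a b : nrm a - nrm b <= nrm (a - b).
  by rewrite lerBlDr -{1}(subrK b a) ler_nrmD.
by rewrite ler_norml lerNl opprB h nrm_distC h.
Qed.

Lemma ler_nrm_sum (I : finType) (F : I -> 'rV[R]_d) :
  nrm (\sum_i F i) <= \sum_i nrm (F i).
Proof.
apply: (big_ind2 (fun x y => nrm x <= y)) => //; first by rewrite nrm0.
by move=> a b a' b' ha hb; apply: le_trans (ler_nrmD _ _) (lerD ha hb).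
Qed.

Lemma nrm_le_coord : exists2 K : R, 0 < K &
  forall x, nrm x <= K * \sum_i `|x 0 i|.
Proof.
(* The summand 1 keeps the constant positive, also for [d = 0]. *)
exists (1 + \sum_i nrm (delta_mx 0 i)).
  by rewrite ltr_pwDl// sumr_ge0// => i _; exact: nrm_ge0.
move=> x; rewrite {1}(row_sum_delta x).
apply: le_trans (ler_nrm_sum _) _.
rewrite mulr_sumr; apply: ler_sum => i _.
rewrite nrmZ mulrC ler_wpM2r// (bigD1 i)//= addrCA ler_wpDr//.
by rewrite addr_ge0// sumr_ge0// => j _; exact: nrm_ge0.
Qed.

Lemma coord_le_mx_norm (x : 'rV[R]_d) i : `|x 0 i| <= `|x|.
Proof.
have /mapP[j Hj ->] : `|x ord0 i| \in [seq `|x k.1 k.2| | k : 'I_1 * 'I_d].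
  by apply/mapP; exists (ord0, i) => //=; rewrite mem_enum.
by rewrite [leRHS]/Num.norm /= mx_normrE; apply/bigmax_geP; right => /=; exists j.
Qed.

Lemma nrm_continuous : continuous nrm.
Proof.
have [K K0 hK] := nrm_le_coord.
move=> x; apply/(@cvgrPdist_lt _ _ _ (nbhs x)) => e e0.
have Kd : 0 < K * (d.+1)%:R by rewrite mulr_gt0// ltr0n.
near=> y.
apply: le_lt_trans (ler_nrm_dist _ _) _.
apply: le_lt_trans (hK _) _.
apply: (@le_lt_trans _ _ (K * (d.+1%:R * `|x - y|))).
  rewrite ler_pM2l//.
  apply: (@le_trans _ _ (\sum_(i < d) `|x - y|)).
    by apply: ler_sum => i _; exact: coord_le_mx_norm.
  by rewrite sumr_const card_ord -[leLHS]mulr_natl ler_wpM2r// ler_nat.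
rewrite mulrA mulrC -ltr_pdivlMr//.
near: y; apply: cvgr_dist_lt => //.
by rewrite divr_gt0.
Unshelve. all: by end_near. Qed.

(** On the compact unit sphere of the sup norm, the continuous function [nrm] attains its minimum;
    definiteness makes it positive, and homogeneity spreads the bound to all vectors. *)
Lemma coord_le_nrm : exists2 K : R, 0 < K & forall (x : 'rV[R]_d) i, `|x 0 i| <= K * nrm x.
Proof.
pose S := [set x : 'rV[R]_d | `|x| = 1].
have cS : compact S.
  apply: bounded_closed_compact.
    by exists 1; split => // M M1 x /= Sx; rewrite Sx; exact: ltW.
  apply: (@closed_comp _ _ (fun x : 'rV[R]_d => `|x|) [set 1]).
    by move=> x _; exact: norm_continuous.
  exact: closed_eq.
(* The sphere is empty only when every vector is zero; then any constant works. *)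
have [x0|] := pselect (S !=set0); last first.
  move=> S0; exists 1 => // x i.
  have [->|x_neq0] := eqVneq x 0; first by rewrite mxE normr0 mul1r nrm_ge0.
  exfalso; apply: S0; exists (`|x|^-1 *: x); rewrite /S /=.
  by rewrite normrZ normfV normr_id mulVf// normr_eq0.
have [c Sc cmin] := EVT_min_rV x0 cS (continuous_subspaceT nrm_continuous).
have c0 : 0 < nrm c.
  rewrite lt_neqAle nrm_ge0 andbT eq_sym; apply/eqP => /nrm_eq0 c0.
  by move: Sc; rewrite inE /S /= c0 normr0 => /eqP; rewrite eq_sym oner_eq0.
exists (nrm c)^-1; first by rewrite invr_gt0.
move=> x i; rewrite mulrC ler_pdivlMr//.
have [->|x_neq0] := eqVneq x 0; first by rewrite mxE normr0 mul0r nrm_ge0.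
have nx0 : 0 < `|x| by rewrite normr_gt0.
have := cmin (`|x|^-1 *: x); rewrite inE /S /=.
rewrite normrZ normfV normr_id mulVf ?gt_eqF// => /(_ erefl).
rewrite nrmZ normfV normr_id mulrC ler_pdivlMr// => h.
rewrite mulrC; apply: le_trans h; rewrite ler_pM2l//; exact: coord_le_mx_norm.
Qed.

End norms.

(* The argument is rounded to a grid, hence takes countably many values. *)
Lemma measurable_fun_lipschitz_comp (R : realType) (d : nat) (dT : measure_display)
    (T : measurableType dT) (phi : 'rV[R]_d -> T -> R) (f : T -> 'rV[R]_d) (L : R) :
  (forall w, measurable_fun setT (phi w)) ->
  (forall w w' y, `|phi w y - phi w' y| <= L * \sum_i `|w 0 i - w' 0 i|) ->
  (forall i, measurable_fun setT (fun y => f y 0 i)) ->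
  measurable_fun setT (fun y => phi (f y) y).
Proof.
move=> mphi Lphi mf.
pose fl n y : 'rV[int]_d := \row_i Num.floor (n.+1%:R * f y 0 i).
pose gr n (k : 'rV[int]_d) : 'rV[R]_d := \row_i ((k 0 i)%:~R / n.+1%:R).
apply: (@measurable_fun_cvg _ _ _ setT (fun n y => phi (gr n (fl n y)) y)).
  move=> n _ A mA; rewrite setTI.
  rewrite (_ : _ @^-1` _ = \bigcup_m (if unpickle m is Some k then
     (fl n @^-1` [set k]) `&` (phi (gr n k) @^-1` A) else set0)); last first.
    apply/seteqP; split => y /=.
      by move=> Ay; exists (pickle (fl n y)) => //; rewrite pickleK.
    by move=> [m _]; case: unpickle => //= k [<-].
  apply: bigcup_measurable => m _; case: unpickle => // k.
  apply: measurableI; last by rewrite -[X in measurable X]setTI; exact: mphi.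
  rewrite (_ : _ @^-1` _ = \bigcap_(i in [set: 'I_d])
     ((fun y => n.+1%:R * f y 0 i) @^-1` `[(k 0 i)%:~R, (k 0 i + 1)%:~R[)); last first.
    apply/seteqP; split => y /=.
      move=> flk i _ /=; rewrite in_itv/= -flk mxE.
      exact: floor_itv.
    move=> h; apply/rowP => i; rewrite mxE.
    have := h i I; rewrite /= in_itv /= => /floor_def; exact.
  apply: fin_bigcap_measurable => // i _.
  rewrite -[X in measurable X]setTI.
  apply: (measurable_funM (measurable_cst _) (mf i)) => //.
move=> y _; apply/cvgrPdist_lt => e e0.
have e1 : 0 < e / (`|L| * d%:R + 1) by rewrite divr_gt0// ltr_wpDl// mulr_ge0.
near=> n.
apply: le_lt_trans (Lphi _ _ _) _.
apply: (@le_lt_trans _ _ ((`|L| * d%:R) / n.+1%:R)).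
  rewrite -mulrA; apply: (@le_trans _ _ (`|L| * \sum_(i < d) `|f y 0 i - gr n (fl n y) 0 i|)).
    by rewrite ler_wpM2r ?ler_norm// sumr_ge0.
  rewrite ler_wpM2l//.
  apply: (@le_trans _ _ (\sum_(i < d) n.+1%:R^-1)); last first.
    by rewrite sumr_const card_ord -[leLHS]mulr_natl.
  apply: ler_sum => i _; rewrite !mxE.
  have n0 : 0 < n.+1%:R :> R by rewrite ltr0n.
  rewrite -(ler_pM2l n0) divff ?gt_eqF// -{1}(gtr0_norm n0) -normrM mulrBr.
  rewrite [X in _ - X]mulrCA divff ?gt_eqF// mulr1.
  have := floor_itv (n.+1%:R * f y 0 i); rewrite intrD ler_norml; lra.
apply: (@le_lt_trans _ _ ((`|L| * d%:R + 1) / n.+1%:R)).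
  by rewrite ler_wpM2r// lerDl.
rewrite mulrC -ltr_pdivlMr ?ltr_wpDl//.
near: n; exact: (near_infty_natSinv_lt (PosNum e1)).
Unshelve. all: by end_near. Qed.

(** * Bounded measurable functions *)

Lemma ler_sum_cst (R : numDomainType) (d : nat) (F : 'I_d -> R) (c : R) :
  (forall i, F i <= c) -> \sum_i F i <= d%:R * c.
Proof.
move=> Fc; apply: (@le_trans _ _ (\sum_(i < d) c)); first exact: ler_sum.
by rewrite sumr_const card_ord -[leLHS]mulr_natl.
Qed.

(** Every random quantity below is bounded at each fixed time, so this class, closed under the
    algebraic operations, makes integrability conditions automatic. *)
Definition bmf (R : realType) (dT : measure_display) (T : measurableType dT)
    (f : T -> R) : Prop :=
  measurable_fun setT f /\ exists M, forall x, `|f x| <= M.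

Section bounded_measurable.
Context {R : realType} {dT : measure_display} {T : measurableType dT}.
Implicit Types f g : T -> R.

Lemma bmf_cst (c : R) : bmf (fun _ : T => c).
Proof. by split; [exact: measurable_cst|exists `|c|]. Qed.

Lemma bmfD f g : bmf f -> bmf g -> bmf (fun x => f x + g x).
Proof.
move=> [mf [M hM]] [mg [N hN]]; split; first exact: measurable_funD.
by exists (M + N) => x; rewrite (le_trans (ler_normD _ _))// lerD.
Qed.

Lemma bmfM f g : bmf f -> bmf g -> bmf (fun x => f x * g x).
Proof.
move=> [mf [M hM]] [mg [N hN]]; split; first exact: measurable_funM.
by exists (M * N) => x; rewrite normrM ler_pM.
Qed.

Lemma bmfZ c f : bmf f -> bmf (fun x => c * f x).
Proof. by move=> bf; apply: bmfM => //; exact: bmf_cst. Qed.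

Lemma bmfN f : bmf f -> bmf (fun x => - f x).
Proof.
by move=> bf; under eq_fun do rewrite -mulN1r; exact: bmfZ.
Qed.

Lemma bmfB f g : bmf f -> bmf g -> bmf (fun x => f x - g x).
Proof. by move=> bf bg; apply: bmfD => //; exact: bmfN. Qed.

Lemma bmf_norm f : bmf f -> bmf (fun x => `|f x|).
Proof.
move=> [mf [M hM]]; split; first exact: measurableT_comp.
by exists M => x; rewrite normr_id.
Qed.

Lemma bmfX f n : bmf f -> bmf (fun x => f x ^+ n).
Proof.
move=> bf; elim: n => [|n IH]; first exact: bmf_cst.
by under eq_fun do rewrite exprS; exact: bmfM.
Qed.

Lemma bmf_sum (I : Type) (s : seq I) (F : I -> T -> R) :
  (forall i, bmf (F i)) -> bmf (fun x => \sum_(i <- s) F i x).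
Proof.
move=> bF; elim: s => [|i s IH].
  by under eq_fun do rewrite big_nil; exact: bmf_cst.
by under eq_fun do rewrite big_cons; exact: bmfD.
Qed.

Lemma bmf_indic (A : set T) : measurable A -> bmf (\1_A : T -> R).
Proof.
move=> mA; split; first exact: measurable_indic.
by exists 1 => x; rewrite indicE; case: (_ \in _); rewrite ?normr1 ?normr0.
Qed.

Context (mu : {measure set T -> \bar R}) (mufin : (mu setT < +oo)%E).
Context (D : set T) (mD : measurable D).

Lemma bmf_integrable f : bmf f -> mu.-integrable D (EFin \o f).
Proof.
move=> [mf [M hM]]; apply: measurable_bounded_integrable => //.
- by apply: le_lt_trans mufin; apply: le_measure; rewrite ?inE.
- exact: measurable_funTS.
- exists M; split; first by rewrite num_real.
  by move=> N MN x _; apply: le_trans (hM x) (ltW MN).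
Qed.

Lemma bmf_RintegralD f g : bmf f -> bmf g ->
  \int[mu]_(x in D) (f x + g x) = \int[mu]_(x in D) f x + \int[mu]_(x in D) g x.
Proof. by move=> bf bg; rewrite RintegralD//; exact: bmf_integrable. Qed.

Lemma bmf_RintegralB f g : bmf f -> bmf g ->
  \int[mu]_(x in D) (f x - g x) = \int[mu]_(x in D) f x - \int[mu]_(x in D) g x.
Proof. by move=> bf bg; rewrite RintegralB//; exact: bmf_integrable. Qed.

Lemma bmf_RintegralZ c f : bmf f ->
  \int[mu]_(x in D) (c * f x) = c * \int[mu]_(x in D) f x.
Proof. by move=> bf; rewrite RintegralZl//; exact: bmf_integrable. Qed.

Lemma bmf_RintegralN f : bmf f ->
  \int[mu]_(x in D) (- f x) = - \int[mu]_(x in D) f x.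
Proof.
move=> bf; rewrite -mulN1r -bmf_RintegralZ//.
by apply: eq_Rintegral => x _; rewrite mulN1r.
Qed.

Lemma bmf_Rintegral_sum (I : Type) (s : seq I) (F : I -> T -> R) :
  (forall i, bmf (F i)) -> \int[mu]_(x in D) (\sum_(i <- s) F i x) =
  \sum_(i <- s) \int[mu]_(x in D) F i x.
Proof.
move=> bF; elim: s => [|i s IH].
  under eq_Rintegral do rewrite big_nil.
  by rewrite big_nil Rintegral_cst// mul0r.
under eq_Rintegral do rewrite big_cons.
by rewrite bmf_RintegralD ?IH ?big_cons//; exact: bmf_sum.
Qed.

Lemma bmf_le_Rintegral f g : bmf f -> bmf g -> (forall x, D x -> f x <= g x) ->
  \int[mu]_(x in D) f x <= \int[mu]_(x in D) g x.
Proof. by move=> bf bg fg; apply: le_Rintegral => //; exact: bmf_integrable. Qed.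

Lemma bmf_ler_norm_Rintegral f g : bmf f -> bmf g ->
  (forall x, D x -> `|f x| <= g x) ->
  `|\int[mu]_(x in D) f x| <= \int[mu]_(x in D) g x.
Proof.
move=> bf bg fg; rewrite ler_norml -bmf_RintegralN//; apply/andP; split.
  apply: bmf_le_Rintegral => //; first exact: bmfN.
  by move=> x /fg; rewrite ler_norml => /andP[].
by apply: bmf_le_Rintegral => // x /fg; rewrite ler_norml => /andP[].
Qed.

End bounded_measurable.

Lemma probability_ltoo (R : realType) (dT : measure_display)
  (T : measurableType dT) (mu : probability T R) : (mu setT < +oo)%E.
Proof. by rewrite probability_setT ltry. Qed.

Lemma Rintegral_prob_cst (R : realType) (dT : measure_display)
  (T : measurableType dT) (mu : probability T R) (c : R) : \int[mu]_x c = c.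
Proof.
rewrite Rintegral_cst// -[RHS]mulr1; congr (_ * _).
rewrite -[RHS]/(fine 1%E); congr fine; exact: probability_setT.
Qed.

(** * Positive functionals and approximation by level sets *)

Section functional.
Context {R : realType} {dT : measure_display} {T : measurableType dT}.

Definition nbmf (f : T -> R) := bmf f /\ forall x, 0 <= f x.

Lemma nbmfD f g : nbmf f -> nbmf g -> nbmf (fun x => f x + g x).
Proof. by move=> [bf f0] [bg g0]; split; [exact: bmfD|move=> x; exact: addr_ge0]. Qed.

Lemma nbmfZ c f : 0 <= c -> nbmf f -> nbmf (fun x => c * f x).
Proof. by move=> c0 [bf f0]; split; [exact: bmfZ|move=> x; exact: mulr_ge0]. Qed.

Lemma nbmf_cst (c : R) : 0 <= c -> nbmf (fun _ : T => c).
Proof. by move=> c0; split => //; exact: bmf_cst. Qed.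

Lemma nbmf_indic (A : set T) : measurable A -> nbmf (\1_A : T -> R).
Proof. by move=> mA; split => //; exact: bmf_indic. Qed.

(** Three functionals are compared through this interface: the integral of [f (X t)] over an event,
    the same with one kernel step inserted, and a multiple of the stationary integral. These axioms
    let closeness on indicators control closeness on functions. *)
Definition pos_functional (I : (T -> R) -> R) : Prop :=
  [/\ forall f g, nbmf f -> nbmf g -> I (fun x => f x + g x) = I f + I g,
      forall c f, 0 <= c -> nbmf f -> I (fun x => c * f x) = c * I f
    & forall f g, nbmf f -> nbmf g -> (forall x, f x <= g x) -> I f <= I g].

(** For values in [[0, 1]] and positive [N] this is [f] rounded down to a multiple of [1/N], written
    as an average of indicators of level sets. *)
Definition layers (N : nat) (f : T -> R) (x : T) : R :=
  \sum_(k < N) N%:R^-1 * \1_[set y | k.+1%:R <= N%:R * f y] x.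

(** [S] counts the integers from 1 to [N] that are at most [x]: it is the floor of [x] until it
    saturates at [N], which is the last alternative. *)
Lemma count_layers (N : nat) (x : R) : 0 <= x ->
  let S : R := \sum_(k < N) (k.+1%:R <= x :> R)%:R in
  [/\ S <= x, S <= N%:R & (x <= S + 1) \/ S = N%:R].
Proof.
move=> x0; elim: N => [|N /= [S1 S2 S3]] /=.
  by rewrite big_ord0; split => //; right.
rewrite big_ord_recr /=; set S := \sum_(_ < N) _ in S1 S2 S3 *.
rewrite -natr1 in S1 S2 S3 *.
case: (leP (N%:R + 1) x) => h; split; rewrite ?addr0 ?natr1 //=.
- by rewrite -natr1; lra.
- by rewrite -natr1; lra.
- by right; case: S3 => [|->]; rewrite -?natr1 //; lra.
- by rewrite -natr1; lra.
- by left; case: S3 => [|->]; lra.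
Qed.

Lemma layers_itv N (f : T -> R) x : 0 <= f x <= 1 ->
  layers N.+1 f x <= f x <= layers N.+1 f x + N.+1%:R^-1.
Proof.
move=> /andP[f0 f1].
have n0 : 0 < N.+1%:R :> R by rewrite ltr0n.
have [] := @count_layers N.+1 (N.+1%:R * f x).
  by rewrite mulr_ge0.
set S := \sum_(_ < _) _ => S1 S2 S3.
have -> : layers N.+1 f x = N.+1%:R^-1 * S.
  rewrite /layers -mulr_sumr; congr (_ * _); apply: eq_bigr => k _.
  by rewrite indicE; congr (_%:R); congr nat_of_bool; apply/idP/idP; rewrite inE.
have S4 : N.+1%:R * f x <= S + 1.
  case: S3 => // ->; rewrite -[leLHS]addr0 lerD//.
  by rewrite -[leRHS]mulr1 ler_pM2l.
rewrite -(ler_pM2l n0) -[X in _ && X](ler_pM2l n0) mulrDr !mulrA.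
by rewrite divff ?gt_eqF// mul1r S1.
Qed.

Lemma measurable_layer (c r : R) (f : T -> R) : measurable_fun setT f ->
  measurable [set y | r <= c * f y].
Proof.
move=> mf; have /= := measurable_funM (measurable_cst (c : R)) mf.
move=> /(_ measurableT `[r, +oo[%classic (measurable_itv _)).
by congr measurable; rewrite setTI; apply/seteqP; split => y /=;
  rewrite in_itv /= andbT.
Qed.

Lemma nbmf_layers N (f : T -> R) : measurable_fun setT f -> nbmf (layers N f).
Proof.
move=> mf; split.
  apply: bmf_sum => k; apply: bmfZ; apply: bmf_indic.
  exact: measurable_layer.
by move=> x; rewrite sumr_ge0// => k _; rewrite mulr_ge0.
Qed.

Lemma pos_functional_sum I (J : Type) (s : seq J) (F : J -> T -> R) :
  pos_functional I -> (forall j, nbmf (F j)) ->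
  I (fun x => \sum_(j <- s) F j x) = \sum_(j <- s) I (F j).
Proof.
move=> [ID IZ _] bF; have bs s' : nbmf (fun x => \sum_(j <- s') F j x).
  split; first by apply: bmf_sum => j; case: (bF j).
  by move=> x; apply: sumr_ge0 => j _; case: (bF j).
elim: s => [|j s IH].
  have := IZ 0 (fun=> 0) (lexx _) (nbmf_cst (lexx _)).
  rewrite [RHS]mul0r big_nil => I0; rewrite -[RHS]I0.
  by congr I; apply/funext => x; rewrite big_nil mul0r.
rewrite big_cons -IH -ID//; congr I; apply/funext => x; by rewrite big_cons.
Qed.

(** The weights in [layers] sum to one, so the error [e] on indicators passes to layered functions
    without loss; monotonicity then pins each functional down to [1/N] times its value at the
    constant 1. With [e = 0] the conclusion is an equality. *)
Lemma pos_functional_close (I J : (T -> R) -> R) (e : R) :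
  pos_functional I -> pos_functional J ->
  (forall A, measurable A -> `|I \1_A - J \1_A| <= e) ->
  forall f : T -> R, measurable_fun setT f -> (forall x, 0 <= f x <= 1) ->
  `|I f - J f| <= e.
Proof.
move=> pI pJ IJ f mf f01.
have nf : nbmf f.
  split; last by move=> x; case/andP: (f01 x).
  by split => //; exists 1 => x; case/andP: (f01 x) => f0 f1; rewrite ger0_norm.
have mA (N k : nat) : measurable [set y | k.+1%:R <= N%:R * f y].
  exact: measurable_layer.
have layE I' N : pos_functional I' -> I' (layers N f) =
    \sum_(k < N) N%:R^-1 * I' \1_[set y | k.+1%:R <= N%:R * f y].
  move=> pI'; rewrite /layers (pos_functional_sum _ pI'); last first.
    by move=> k; apply: nbmfZ; rewrite ?invr_ge0//; exact: nbmf_indic.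
  by apply: eq_bigr => k _; case: pI' => _ + _; apply => //; exact: nbmf_indic.
have close N : `|I (layers N.+1 f) - J (layers N.+1 f)| <= e.
  rewrite !layE// -sumrB; under eq_bigr do rewrite -mulrBr.
  apply: le_trans (ler_norm_sum _ _ _) _.
  apply: (@le_trans _ _ (\sum_(k < N.+1) N.+1%:R^-1 * e)).
    apply: ler_sum => k _; rewrite normrM ger0_norm ?invr_ge0//.
    by rewrite ler_wpM2l ?invr_ge0// IJ.
  by rewrite sumr_const card_ord -[leLHS]mulr_natl mulrA divff ?mul1r// pnatr_eq0.
have upper I' N : pos_functional I' -> I' (layers N.+1 f) <= I' f <=
    I' (layers N.+1 f) + N.+1%:R^-1 * I' (fun=> 1).
  move=> [ID IZ Im]; have nl := nbmf_layers N.+1 mf.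
  have n1 : nbmf (fun _ : T => N.+1%:R^-1 * 1 : R).
    by apply: nbmf_cst; rewrite mulr1 invr_ge0.
  rewrite -IZ ?invr_ge0//; last exact: nbmf_cst.
  rewrite -ID//; apply/andP; split; apply: Im => //.
  - by move=> x; case/andP: (layers_itv N (f01 x)).
  - exact: nbmfD.
  - by move=> x; rewrite mulr1; case/andP: (layers_itv N (f01 x)).
apply/ler_addgt0Pr => r r0.
(* [c] dominates both total masses, so the rounding error drops below [r] for a suitable [N]. *)
pose c := `|I (fun=> 1)| + `|J (fun=> 1)| + 1.
have c0 : 0 < c by rewrite ltr_wpDl// addr_ge0.
have rc : 0 < r / c by rewrite divr_gt0.
have [N _ hN] := near_infty_natSinv_lt (PosNum rc).
have {}hN : N.+1%:R^-1 * c < r by have := hN N (leqnn _); rewrite /= ltr_pdivlMr.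
have N0 : 0 <= N.+1%:R^-1 :> R by rewrite invr_ge0.
have := close N; have := upper _ N pI; have := upper _ N pJ.
have h1 : N.+1%:R^-1 * I (fun=> 1) <= N.+1%:R^-1 * c.
  by rewrite ler_wpM2l// /c (le_trans (ler_norm _))// -addrA lerDl addr_ge0.
have h2 : N.+1%:R^-1 * J (fun=> 1) <= N.+1%:R^-1 * c.
  by rewrite ler_wpM2l// /c (le_trans (ler_norm _))// addrAC lerDr addr_ge0.
move: (le_lt_trans h1 hN) (le_lt_trans h2 hN); rewrite !ler_norml.
move: (_ * I _) (_ * J _) (I (layers _ _)) (J (layers _ _)) => p q a b.
by move=> ? ? /andP[? ?] /andP[? ?] /andP[? ?]; apply/andP; split; lra.
Qed.

End functional.

(** * Mixing of the chain *)

Section markov.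
Context {R : realType} {dY : measure_display} {Y : measurableType dY}
  (P : R.-pker Y ~> Y) (dO : measure_display) (Omega : measurableType dO)
  (Prob : probability Omega R) (X : nat -> Omega -> Y)
  (mc : markov_chain Prob P X).

Definition filtration_gen (t : nat) : set (set Omega) :=
  [set B | exists s A, (s <= t)%N /\ measurable A /\ B = X s @^-1` A].

Lemma chain_measurable t : measurable_fun setT (X t).
Proof. by case: mc. Qed.

Lemma filtration_sub t B : nat_filtration X t B -> measurable B.
Proof.
apply: smallest_sub; first exact: sigma_algebra_measurable.
move=> _ [s [A [_ [mA ->]]]].
by rewrite -[X in measurable X]setTI; exact: chain_measurable.
Qed.

Lemma filtration_mono s t : (s <= t)%N ->
  nat_filtration X s `<=` nat_filtration X t.
Proof.
move=> st; apply: sub_sigma_algebra2 => B [r [A [rs h]]].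
by exists r, A; split => //; exact: leq_trans st.
Qed.

Lemma filtration_funS s t (f : Omega -> R) : (s <= t)%N ->
  measurable_fun (setT : set (g_sigma_algebraType (filtration_gen s))) f ->
  measurable_fun (setT : set (g_sigma_algebraType (filtration_gen t))) f.
Proof.
by move=> st mf _ A mA; apply: (filtration_mono st); exact: mf.
Qed.

Lemma filtration_fun t (f : Omega -> R) :
  measurable_fun (setT : set (g_sigma_algebraType (filtration_gen t))) f ->
  measurable_fun setT f.
Proof. by move=> mf _ A mA; apply: (@filtration_sub t); exact: mf. Qed.

Lemma chain_adapted s t : (s <= t)%N ->
  measurable_fun (setT : set (g_sigma_algebraType (filtration_gen t))) (X s).
Proof.
move=> st _ A mA; apply: sub_sigma_algebra.
by exists s, A; rewrite setTI.
Qed.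

Lemma chain_adapted_comp (f : Y -> R) t : measurable_fun setT f ->
  measurable_fun (setT : set (g_sigma_algebraType (filtration_gen t)))
    (fun om => f (X t om)).
Proof.
move=> mf _ A mA; apply: (@chain_adapted t t (leqnn t) measurableT (f @^-1` A)).
by rewrite -[X in measurable X]setTI; exact: mf.
Qed.

Lemma kiter_itv_measurable n A : measurable A ->
  (forall y, 0 <= kiter P n y A <= 1)%E /\
  measurable_fun setT (fun y => kiter P n y A).
Proof.
move=> mA; elim: n => [|n [k01 mk]] /=.
  split.
    by move=> y; rewrite diracE !lee_fin; case: (_ \in _); rewrite ?lexx ler01.
  apply/measurable_EFinP; exact: measurable_indic.
have k0 z : (0 <= kiter P n z A)%E by case/andP: (k01 z).
split; last first.
  by apply: (measurable_fun_integral_kernel (measurable_kernel P)).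
move=> y; rewrite integral_ge0 //=.
rewrite -(@prob_kernel _ _ _ _ _ P y) -[leRHS]mul1e -(@integral_cst _ _ _ (P y) setT)//.
by apply: ge0_le_integral => // z _; case/andP: (k01 z).
Qed.

Definition kiterR n A y := fine (kiter P n y A).

Lemma kiterRK n A y : measurable A -> (kiterR n A y)%:E = kiter P n y A.
Proof.
move=> mA; have [/(_ y)/andP[k0 k1] _] := kiter_itv_measurable n mA.
by rewrite fineK// ge0_fin_numE// (le_lt_trans k1)// ltry.
Qed.

Lemma nbmf_kiterR n A : measurable A -> nbmf (kiterR n A).
Proof.
move=> mA; have [k01 mk] := kiter_itv_measurable n mA.
have r01 y : 0 <= kiterR n A y <= 1 by rewrite -!lee_fin kiterRK.
split; last by move=> y; case/andP: (r01 y).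
split; first by apply: measurableT_comp mk; exact: fine_measurable.
by exists 1 => y; case/andP: (r01 y) => r0 r1; rewrite ger0_norm.
Qed.

Lemma kiterR0 A y : kiterR 0 A y = \1_A y.
Proof. by rewrite /kiterR /kiter diracE indicE. Qed.

Lemma kiterRS n A y : measurable A ->
  kiterR n.+1 A y = \int[P y]_z kiterR n A z.
Proof.
move=> mA; rewrite /kiterR/= /Rintegral; congr fine.
by apply: eq_integral => z _; rewrite -kiterRK.
Qed.

Lemma kernel_ltoo y : (P y setT < +oo)%E.
Proof. by rewrite prob_kernel ltry. Qed.

Lemma bmf_kernel (f : Y -> R) t : nbmf f ->
  bmf (fun om => \int[P (X t om)]_z f z).
Proof.
move=> [bf f0]; have [mf [M hM]] := bf; split.
  apply: (@measurableT_comp _ _ _ _ _ _ (fun y => \int[P y]_z f z)) => //; last first.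
    exact: chain_measurable.
  apply: measurableT_comp; first exact: fine_measurable.
  apply: (measurable_fun_integral_kernel (measurable_kernel P)) => //.
  exact/measurable_EFinP.
exists M => om; have := bmf_ler_norm_Rintegral (kernel_ltoo (X t om)) measurableT
  bf (bmf_cst M) (fun x _ => hM x).
by rewrite Rintegral_cst// prob_kernel mulr1.
Qed.

Lemma bmf_chain (f : Y -> R) t : bmf f -> bmf (fun om => f (X t om)).
Proof.
move=> [mf [M hM]]; split; last by exists M => om.
by apply: measurableT_comp => //; exact: chain_measurable.
Qed.

Lemma pos_functional_chain B t : measurable B ->
  pos_functional (fun f : Y -> R => \int[Prob]_(om in B) f (X t om)).
Proof.
move=> mB; split.
- move=> f g [bf _] [bg _].
  by rewrite (bmf_RintegralD (probability_ltoo Prob) mB)//; exact: bmf_chain.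
- move=> c f c0 [bf _].
  by rewrite (bmf_RintegralZ (probability_ltoo Prob) mB)//; exact: bmf_chain.
- move=> f g [bf _] [bg _] fg.
  by apply: (bmf_le_Rintegral (probability_ltoo Prob) mB) => //; exact: bmf_chain.
Qed.

Lemma pos_functional_kernel B t : measurable B ->
  pos_functional (fun f : Y -> R =>
    \int[Prob]_(om in B) (\int[P (X t om)]_z f z)).
Proof.
move=> mB; split.
- move=> f g nf ng.
  rewrite -(bmf_RintegralD (probability_ltoo Prob) mB); [|exact: bmf_kernel..].
  apply: eq_Rintegral => om _.
  by rewrite (bmf_RintegralD (kernel_ltoo _))//; [case: nf|case: ng].
- move=> c f c0 nf.
  rewrite -(bmf_RintegralZ (probability_ltoo Prob) mB); last exact: bmf_kernel.
  apply: eq_Rintegral => om _.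
  by rewrite (bmf_RintegralZ (kernel_ltoo _))//; case: nf.
- move=> f g nf ng fg.
  apply: (bmf_le_Rintegral (probability_ltoo Prob) mB); [exact: bmf_kernel..|].
  move=> om _; apply: (bmf_le_Rintegral (kernel_ltoo _)) => //.
    by case: nf.
  by case: ng.
Qed.

(** Both sides are positive functionals of [f] that agree on indicators by the definition of the
    chain, so they are close with error 0. *)
Lemma markov_Rintegral t B (f : Y -> R) : nat_filtration X t B ->
  measurable_fun setT f -> (forall y, 0 <= f y <= 1) ->
  \int[Prob]_(om in B) f (X t.+1 om) =
  \int[Prob]_(om in B) (\int[P (X t om)]_z f z).
Proof.
move=> FB mf f01; have mB := filtration_sub FB.
apply/eqP; rewrite -subr_eq0 -normr_le0.
apply: (pos_functional_close (pos_functional_chain t.+1 mB)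
  (pos_functional_kernel t mB) _ mf f01) => A mA.
rewrite (_ : \int[Prob]_(om in B) \1_A (X t.+1 om) =
  \int[Prob]_(om in B) (\int[P (X t om)]_z \1_A z)) ?subrr ?normr0//.
rewrite /Rintegral; congr fine.
transitivity (Prob (B `&` X t.+1 @^-1` A)).
  rewrite setIC -integral_indic//.
  by rewrite -[X in measurable X]setTI; exact: chain_measurable.
case: mc => _ ->//; apply: eq_integral => om _.
rewrite integral_indic// setIT fineK// ge0_fin_numE//.
by rewrite (le_lt_trans _ (kernel_ltoo (X t om)))// le_measure ?inE.
Qed.

(** Each step trades one step of the chain for one more iterate of the kernel; [m] stays general
    because it grows along the induction. *)
Lemma Rintegral_kiter s n m B A : nat_filtration X s B -> measurable A ->
  \int[Prob]_(om in B) kiterR m A (X (s + n)%N om) =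
  \int[Prob]_(om in B) kiterR (m + n)%N A (X s om).
Proof.
move=> FB mA; elim: n m => [|n IH] m; first by rewrite !addn0.
rewrite addnS -[(m + n.+1)%N]addSnnS -IH.
rewrite (@markov_Rintegral (s + n)%N B (kiterR m A)).
- by apply: eq_Rintegral => om _; rewrite kiterRS.
- exact: (filtration_mono (leq_addr _ _)).
- by case: (nbmf_kiterR m mA) => -[].
- by have [k01 _] := kiter_itv_measurable m mA; move=> y; rewrite -!lee_fin kiterRK.
Qed.

Context (dist : probability Y R) (C rho : R)
  (mix : forall (y : Y) (n : nat) (A : set Y), measurable A ->
       (`| kiter P n y A - dist A | <= (C * rho ^+ n)%:E)%E).

Lemma mixing_indic s n B A : nat_filtration X s B -> measurable A ->
  `|\int[Prob]_(om in B) \1_A (X (s + n)%N om) - fine (Prob B) * fine (dist A)|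
  <= C * rho ^+ n * fine (Prob B).
Proof.
move=> FB mA; have mB := filtration_sub FB.
have -> : \int[Prob]_(om in B) \1_A (X (s + n)%N om) =
    \int[Prob]_(om in B) kiterR n A (X s om).
  rewrite -(Rintegral_kiter n 0 FB mA).
  by apply: eq_Rintegral => om _; rewrite kiterR0.
rewrite [X in _ - X]mulrC -!(Rintegral_cst Prob mB).
have bk : bmf (fun om => kiterR n A (X s om)).
  by apply: bmf_chain; case: (nbmf_kiterR n mA).
rewrite -(bmf_RintegralB (probability_ltoo Prob) mB)//; last exact: bmf_cst.
apply: (bmf_ler_norm_Rintegral (probability_ltoo Prob) mB).
- by apply: bmfB => //; exact: bmf_cst.
- exact: bmf_cst.
- move=> om _; rewrite -lee_fin; apply: le_trans (mix (X s om) n mA).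
  rewrite -(kiterRK n (X s om) mA).
  rewrite -[in leRHS](@fineK _ (dist A))//.
  by rewrite fin_num_measure.
Qed.

Lemma pos_functional_dist c : 0 <= c ->
  pos_functional (fun f : Y -> R => c * \int[dist]_y f y).
Proof.
move=> c0; split.
- move=> f g [bf _] [bg _].
  by rewrite (bmf_RintegralD (probability_ltoo dist))// mulrDr.
- move=> a f a0 [bf _].
  by rewrite (bmf_RintegralZ (probability_ltoo dist))// mulrCA.
- move=> f g [bf _] [bg _] fg; rewrite ler_wpM2l//.
  by apply: (bmf_le_Rintegral (probability_ltoo dist)).
Qed.

(** The factor [2 * M] is the length of the range of [g]: an affine map takes [[-M, M]] to the unit
    interval, where the bound for indicators extends unchanged. *)
Lemma mixing_bounded s n B (g : Y -> R) M : nat_filtration X s B ->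
  measurable_fun setT g -> (forall y, `|g y| <= M) ->
  `|\int[Prob]_(om in B) g (X (s + n)%N om) - fine (Prob B) * \int[dist]_y g y|
  <= 2 * M * (C * rho ^+ n * fine (Prob B)).
Proof.
move=> FB mg gM; have mB := filtration_sub FB.
have M0 : 0 <= M by apply: le_trans (gM point).
(* For [M = 0] the inverse of zero is zero: [f] and [g] both vanish and the affine identity still
   holds. *)
pose f y := (2 * M)^-1 * (g y + M).
have gE y : g y = 2 * M * f y + - M.
  rewrite /f; have [M00|Mn0] := eqVneq M 0.
    by move: (gM y); rewrite M00 normr_le0 => /eqP ->; rewrite mulr0 mul0r subr0.
  by rewrite mulrA divff ?mul1r ?addrK// mulf_neq0.
have bg : bmf g by split => //; exists M.
have bf : bmf f by apply: bmfZ; apply: bmfD => //; exact: bmf_cst.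
have f01 y : 0 <= f y <= 1.
  rewrite /f; have [->|Mn0] := eqVneq M 0; first by rewrite mulr0 invr0 mul0r lexx ler01.
  have Mgt0 : 0 < 2 * M by rewrite mulr_gt0// lt_neqAle eq_sym Mn0.
  move: (gM y); rewrite ler_norml => /andP[g1 g2].
  rewrite mulr_ge0 ?invr_ge0 ?(ltW Mgt0)//=; last lra.
  by rewrite mulrC ler_pdivrMr// mul1r; lra.
have PB0 : 0 <= fine (Prob B) by rewrite fine_ge0.
have close : `|\int[Prob]_(om in B) f (X (s + n)%N om) -
    fine (Prob B) * \int[dist]_y f y| <= C * rho ^+ n * fine (Prob B).
  apply: (pos_functional_close (pos_functional_chain (s + n)%N mB)
    (pos_functional_dist PB0) _ (proj1 bf) f01) => A mA.
  have -> : \int[dist]_y \1_A y = fine (dist A).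
    by rewrite /Rintegral integral_indic ?setIT.
  exact: mixing_indic.
have bfX := bmf_chain (s + n)%N bf.
have -> : \int[Prob]_(om in B) g (X (s + n)%N om) =
    2 * M * \int[Prob]_(om in B) f (X (s + n)%N om) - M * fine (Prob B).
  rewrite -mulNr -(Rintegral_cst Prob mB) -(bmf_RintegralZ (probability_ltoo Prob) mB)//.
  rewrite -(bmf_RintegralD (probability_ltoo Prob) mB); [|exact: bmfZ|exact: bmf_cst].
  by apply: eq_Rintegral => om _; rewrite gE.
have -> : \int[dist]_y g y = 2 * M * \int[dist]_y f y - M.
  under eq_Rintegral do rewrite gE.
  rewrite (bmf_RintegralD (probability_ltoo dist))//; [|exact: bmfZ|exact: bmf_cst].
  rewrite (bmf_RintegralZ (probability_ltoo dist))//.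
  by rewrite Rintegral_prob_cst.
set a := \int[Prob]_(om in B) _ in close *; set b := \int[dist]_y _ in close *.
rewrite (_ : _ - _ = 2 * M * (a - fine (Prob B) * b)); last by ring.
by rewrite normrM ger0_norm ?mulr_ge0// ler_wpM2l// mulr_ge0.
Qed.

End markov.

Lemma small_oscillation_ind (R : realType) (dT : measure_display)
    (T : measurableType dT) (Q : set T -> Prop) (f : nat -> T -> R) (m : nat)
    (delta : R) : 0 < delta ->
  (forall j, measurable_fun setT (f j)) ->
  (forall j, exists M, forall x, `|f j x| <= M) ->
  (forall A B, measurable A -> measurable B -> [disjoint A & B] ->
    Q A -> Q B -> Q (A `|` B)) ->
  (forall B, measurable B ->
    (forall j, (j < m)%N -> forall x y, B x -> B y -> `|f j x - f j y| <= delta) ->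
    Q B) ->
  forall B, measurable B -> Q B.
Proof.
move=> delta0 mf bf QU; elim: m => [|m IH] Qm; first by move=> B mB; exact: Qm.
apply: IH => B mB oscB.
have [M hM] := bf m.
pose a k := - M + k%:R * delta.
have mS r : measurable [set x | f m x < r].
  rewrite -[X in measurable X]setTI.
  have := mf m measurableT `]-oo, r[%classic (measurable_itv _).
  by congr measurable; congr (_ `&` _); apply/seteqP; split => y /=; rewrite in_itv.
have mG r : measurable [set x | r <= f m x].
  rewrite -[X in measurable X]setTI.
  have := mf m measurableT `[r, +oo[%classic (measurable_itv _).
  by congr measurable; congr (_ `&` _); apply/seteqP; split => y /=; rewrite in_itv/= andbT.
have Qk k : Q (B `&` [set x | f m x < a k]).
  elim: k => [|k IHk].
    (* Nothing lies below [a 0 = - M], so the oscillation condition is vacuous. *)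
    apply: Qm; first exact: measurableI.
    move=> j _ x y [_ /=]; rewrite /a mul0r addr0 => fx; exfalso.
    by move: (hM x); rewrite ler_norml; lra.
  have ak : a k.+1 = a k + delta by rewrite /a -natr1; ring.
  rewrite (_ : _ `&` _ = (B `&` [set x | f m x < a k]) `|`
      (B `&` [set x | a k <= f m x] `&` [set x | f m x < a k.+1])); last first.
    apply/seteqP; split => x /=.
      by move=> [Bx fx]; case: (ltP (f m x) (a k)) => h; [left|right].
    by rewrite ak; case=> [[Bx h]|[[Bx _] h]]; split => //; lra.
  apply: QU => //.
  - exact: measurableI.
  - by apply: measurableI => //; exact: measurableI.
  - apply/disj_setPS => x /= [[_ h1] [[_ h2] _]]; lra.
  - apply: Qm; first by apply: measurableI => //; exact: measurableI.
    move=> j; rewrite ltnS leq_eqVlt => /orP[/eqP ->|jm] x y /=.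
      rewrite ak => -[[_ h1] h2] [[_ h3] h4]; rewrite ler_norml; lra.
    by move=> [[Bx _] _] [[By _] _]; exact: oscB.
(* Enough bands for [a k] to exceed every value of [f m]. *)
pose k := (Num.truncn ((2 * `|M| + 1) / delta)).+1.
rewrite (_ : B = B `&` [set x | f m x < a k])//.
apply/seteqP; split; last by move=> x [].
move=> x Bx; split => //=.
have : (2 * `|M| + 1) / delta < k%:R by exact: truncnS_gt.
rewrite ltr_pdivrMr// /a => h; have := hM x; rewrite ler_norml => /andP[_ h2].
by have := ler_norm M; lra.
Qed.

(** * Mixing with a random parameter known at an earlier time *)

Section mixing_parametric.
Context {R : realType} {dY : measure_display} {Y : measurableType dY}
  (P : R.-pker Y ~> Y) (dO : measure_display) (Omega : measurableType dO)
  (Prob : probability Omega R) (X : nat -> Omega -> Y)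
  (mc : markov_chain Prob P X).
Context (dist : probability Y R) (C rho : R) (C0 : 0 <= C) (rho0 : 0 <= rho)
  (mix : forall (y : Y) (n : nat) (A : set Y), measurable A ->
       (`| kiter P n y A - dist A | <= (C * rho ^+ n)%:E)%E).
Context (d : nat) (G : 'rV[R]_d -> Y -> R) (Mb : 'rV[R]_d -> R) (L : R) (L0 : 0 <= L)
  (mG : forall w, measurable_fun setT (G w))
  (GM : forall w y, `|G w y| <= Mb w)
  (G0 : forall w, \int[dist]_y G w y = 0)
  (GL : forall w w' y, `|G w y - G w' y| <= L * \sum_i `|w 0 i - w' 0 i|)
  (ML : forall w w', `|Mb w - Mb w'| <= L * \sum_i `|w 0 i - w' 0 i|).
Context (s n : nat) (Z : Omega -> R) (W : Omega -> 'rV[R]_d)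
  (mZ : measurable_fun (setT : set (g_sigma_algebraType (filtration_gen X s))) Z)
  (mW : forall i, measurable_fun
     (setT : set (g_sigma_algebraType (filtration_gen X s))) (fun om => W om 0 i))
  (bZ : exists M, forall om, `|Z om| <= M)
  (bW : exists M, forall om i, `|W om 0 i| <= M).

Lemma mixing_parametric_bmf :
  bmf (fun om => Z om * G (W om) (X (s + n)%N om)) /\
  bmf (fun om => `|Z om| * Mb (W om)).
Proof.
have [KW hKW] := bW.
have Wb om : \sum_i `|W om 0 i| <= d%:R * KW.
  exact: ler_sum_cst.
have mW' i := filtration_fun mc (@mW i).
have bZ' : bmf Z by split => //; exact: (filtration_fun mc mZ).
have bM : bmf (fun om => Mb (W om)).
  split.
    by apply: (@measurable_fun_lipschitz_comp _ _ _ _ (fun w _ => Mb w) W L).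
  exists (`|Mb 0| + L * (d%:R * KW)) => om.
  rewrite -[X in `|X|](subrK (Mb 0)) addrC (le_trans (ler_normD _ _))// lerD2l.
  apply: le_trans (ML _ _) _; rewrite ler_wpM2l//.
  by under eq_bigr do rewrite mxE subr0.
split; last by apply: bmfM => //; exact: bmf_norm.
apply: bmfM => //; split.
  apply: (@measurable_fun_lipschitz_comp _ _ _ _
    (fun w om => G w (X (s + n)%N om)) W L) => //.
  move=> w; apply: measurableT_comp => //; exact: (chain_measurable mc).
case: bM => _ [M hM]; exists M => om.
exact: le_trans (GM _ _) (le_trans (ler_norm _) (hM om)).
Qed.

(** For constant [Z] and [W] this is the mixing bound for a function of mean zero. In general the
    past is cut into events on which both vary by at most [delta], the bound is used at one base
    point of each event and summed, and [delta] tends to zero. *)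
Lemma mixing_parametric :
  `|\int[Prob]_om (Z om * G (W om) (X (s + n)%N om))| <=
  2 * (C * rho ^+ n) * \int[Prob]_om (`|Z om| * Mb (W om)).
Proof.
have [KZ hKZ] := bZ; have [KW hKW] := bW.
have Plt := probability_ltoo Prob.
have [bF bE] := mixing_parametric_bmf.
set F := (fun om => Z om * _) in bF *; set E := (fun om => _ * Mb _) in bE *.
have KZ0 : 0 <= KZ by apply: le_trans (hKZ point).
have Mb0 w : 0 <= Mb w by apply: le_trans (GM w point).
pose MM := `|Mb 0| + L * (d%:R * KW).
have hMM om : Mb (W om) <= MM.
  rewrite -lerBlDl; apply: (@le_trans _ _ (Mb (W om) - Mb 0)).
    by rewrite lerB// ler_norm.
  apply: le_trans (ler_norm _) _.
  apply: le_trans (ML _ _) _; rewrite ler_wpM2l//.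
  by apply: ler_sum_cst => i; rewrite mxE subr0.
(* Freezing [Z] and [W] at a base point moves both [Z * G] and [|Z| * Mb] by at most
   [c1 * delta]. *)
pose c1 := KZ * (L * d%:R) + MM.
have c10 : 0 <= c1.
  by rewrite addr_ge0 ?mulr_ge0// (le_trans (Mb0 (W point)))//.
pose q := 2 * (C * rho ^+ n).
have q0 : 0 <= q by rewrite !mulr_ge0// exprn_ge0.
(* [F] pays [c1 * delta] once and [q * E] pays it [q] times, hence the factor [q + 1]. *)
have main delta : 0 < delta -> `|\int[Prob]_om F om| <=
    \int[Prob]_om (q * E om + (q + 1) * c1 * delta).
  move=> delta0.
  have bR : bmf (fun om => q * E om + (q + 1) * c1 * delta).
    by apply: bmfD; [exact: bmfZ|exact: bmf_cst].
  (* Indices below [d] give the coordinates of [W] and index [d] gives [Z], so [d + 1] functions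
     must be controlled. *)
  pose f (j : nat) (om : Omega) := if insub j is Some i then W om 0 (i : 'I_d) else Z om.
  apply: (@small_oscillation_ind _ _ (g_sigma_algebraType (filtration_gen X s))
    (fun B => `|\int[Prob]_(om in B) F om| <=
       \int[Prob]_(om in B) (q * E om + (q + 1) * c1 * delta)) f d.+1 delta) => //.
  - by move=> j; rewrite /f; case: insub.
  - by move=> j; rewrite /f; case: insub => [i|]; [exists KW => om|exists KZ].
  - move=> A B /(filtration_sub mc) mA /(filtration_sub mc) mB AB QA QB.
    have mAB : measurable ((A : set Omega) `|` B) by exact: measurableU.
    rewrite !Rintegral_setU//; [|exact: bmf_integrable..].
    by apply: le_trans (ler_normD _ _) (lerD QA QB).
  move=> B FB osc; have mB := filtration_sub mc FB.
  have [->|/set0P[om0 Bom0]] := eqVneq B set0.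
    by rewrite !Rintegral_set0 normr0.
  have oscZ om : B om -> `|Z om - Z om0| <= delta.
    by move=> Bom; have := osc d (ltnSn _) om om0 Bom Bom0; rewrite /f insubN// ltnn.
  have oscW om : B om -> \sum_i `|W om 0 i - W om0 0 i| <= d%:R * delta.
    move=> Bom; apply: ler_sum_cst => i.
    have := osc i (ltnW (ltn_ord i)) om om0 Bom Bom0.
    by rewrite /f valK.
  have bF0 : bmf (fun om => G (W om0) (X (s + n)%N om)).
    by apply: (bmf_chain mc); split => //; exists (Mb (W om0)).
  have bZF0 := bmfZ (Z om0) bF0.
  have PB0 : 0 <= fine (Prob B) by rewrite fine_ge0.
  rewrite (_ : \int[Prob]_(om in B) F om =
     \int[Prob]_(om in B) (F om - Z om0 * G (W om0) (X (s + n)%N om)) +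
     Z om0 * \int[Prob]_(om in B) G (W om0) (X (s + n)%N om)); last first.
    by rewrite (bmf_RintegralB Plt mB)// (bmf_RintegralZ Plt mB)// subrK.
  apply: le_trans (ler_normD _ _) _.
  have h1 : `|\int[Prob]_(om in B) (F om - Z om0 * G (W om0) (X (s + n)%N om))| <=
      \int[Prob]_(om in B) (c1 * delta).
    apply: (bmf_ler_norm_Rintegral Plt mB); [exact: bmfB|exact: bmf_cst|].
    move=> om Bom; rewrite /F.
    rewrite (_ : _ - _ = Z om * (G (W om) (X (s + n)%N om) - G (W om0) (X (s + n)%N om))
       + (Z om - Z om0) * G (W om0) (X (s + n)%N om)); last by ring.
    apply: le_trans (ler_normD _ _) _; rewrite !normrM /c1 mulrDl.
    apply: lerD.
      rewrite -mulrA; apply: ler_pM => //.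
      by apply: le_trans (GL _ _ _) _; rewrite -mulrA ler_wpM2l// oscW.
    rewrite mulrC; apply: ler_pM => //; last exact: oscZ.
    exact: le_trans (GM _ _) _.
  have h2 : `|Z om0 * \int[Prob]_(om in B) G (W om0) (X (s + n)%N om)| <=
      \int[Prob]_(om in B) (q * (`|Z om0| * Mb (W om0))).
    rewrite normrM (Rintegral_cst _ mB).
    have := mixing_bounded mc mix n FB (mG (W om0)) (GM (W om0)).
    rewrite G0 mulr0 subr0 => h.
    apply: (@le_trans _ _ (`|Z om0| * (2 * Mb (W om0) * (C * rho ^+ n * fine (Prob B))))).
      by rewrite ler_wpM2l.
    by rewrite /q le_eqVlt; apply/orP; left; apply/eqP; ring.
  apply: le_trans (lerD h1 h2) _.
  rewrite -(bmf_RintegralD Plt mB); [|exact: bmf_cst..].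
  apply: (bmf_le_Rintegral Plt mB) => //; first exact: bmf_cst.
  move=> om Bom; rewrite addrC [(q + 1) * _]mulrDl mul1r mulrDl addrA lerD2r.
  rewrite -mulrA -mulrDr ler_wpM2l// /E -lerBlDl.
  rewrite (_ : _ - _ = (`|Z om0| - `|Z om|) * Mb (W om0) + `|Z om| * (Mb (W om0) - Mb (W om)));
    last by ring.
  rewrite addrC /c1 [leRHS]mulrDl; apply: lerD.
    apply: le_trans (ler_norm _) _; rewrite normrM normr_id -mulrA ler_pM//.
    rewrite distrC; apply: le_trans (ML _ _) _; rewrite -mulrA ler_wpM2l//; exact: oscW.
  rewrite mulrC; apply: (@le_trans _ _ (Mb (W om0) * delta)).
    rewrite ler_wpM2l//; apply: le_trans (oscZ _ Bom).
    rewrite distrC; apply: le_trans (ler_norm _) _; exact: ler_dist_dist.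
  rewrite ler_wpM2r//; exact: ltW.
apply/ler_addgt0Pr => e e0.
have k0 : 0 < (q + 1) * c1 + 1 by rewrite ltr_wpDl// mulr_ge0// addr_ge0.
have := main _ (divr_gt0 e0 k0).
rewrite (bmf_RintegralD Plt measurableT); [|exact: bmfZ|exact: bmf_cst].
rewrite (bmf_RintegralZ Plt measurableT)// Rintegral_prob_cst.
move/le_trans; apply; rewrite lerD2l mulrA ler_pdivrMr// mulrC ler_pM2l//.
by rewrite lerDl.
Qed.

End mixing_parametric.

(** * Recursions and almost sure convergence *)

Section powers.
Context {R : realType}.
Implicit Types x y s q : R.

Lemma powR_expR x s : 0 < x -> x `^ s = expR (s * ln x).
Proof. by move=> x0; rewrite /powR gt_eqF. Qed.

Lemma powR_add x s q : 0 < x -> x `^ (s + q) = x `^ s * x `^ q.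
Proof. by move=> x0; rewrite !powR_expR// mulrDl expRD. Qed.

(** By convexity of the power, its graph lies above the tangent at [x]. In exponential form this is
    [ln (1 + u) <= u] followed by [1 + u <= expR u]. *)
Lemma powR_tangent x y s : 0 < x -> 0 < y -> 0 <= s ->
  x `^ (- s) * (1 - s * ((y - x) / x)) <= y `^ (- s).
Proof.
move=> x0 y0 s0; rewrite !powR_expR//.
have -> : y = x * (1 + (y - x) / x).
  by rewrite mulrDr mulr1 mulrCA divff ?gt_eqF// mulr1 addrC subrK.
have h0 : 0 < 1 + (y - x) / x.
  by rewrite -(pmulr_rgt0 _ x0) mulrDr mulr1 mulrCA divff ?gt_eqF// mulr1 addrC subrK.
rewrite lnM ?posrE// [- s * (_ + _)]mulrDr expRD ler_wpM2l ?expR_ge0//.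
rewrite [X in 1 - s * (X / x)](_ : _ = y - x); last first.
  by rewrite mulrDr mulr1 mulrCA divff ?gt_eqF// mulr1 [x + _]addrC subrK.
apply: le_trans (expR_ge1Dx _); rewrite lerD2l mulNr lerN2 ler_wpM2l//.
by apply: le_ln1Dx; move: h0; lra.
Qed.

(** By the tangent bound each term is at most the drop of [(t + 2) ^ (- s) / s] over one step, and
    these drops telescope. *)
Lemma powR_sum_bounded s : 0 < s -> exists K, forall n,
  \sum_(0 <= t < n) (t + 3)%:R `^ (- (1 + s)) <= K.
Proof.
move=> s0; exists (s^-1 * 2 `^ (- s)) => n.
suff : \sum_(0 <= t < n) (t + 3)%:R `^ (- (1 + s)) <=
    s^-1 * (2 `^ (- s) - (n + 2)%:R `^ (- s)).
  move/le_trans; apply; rewrite ler_wpM2l ?invr_ge0 ?(ltW s0)//.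
  by rewrite gerBl powR_ge0.
elim: n => [|n IH]; first by rewrite big_geq// add0n subrr mulr0.
rewrite big_nat_recr//=.
have n0 : 0 < (n + 3)%:R :> R by rewrite ltr0n addn_gt0 orbT.
have n2 : 0 < (n + 2)%:R :> R by rewrite ltr0n addn_gt0 orbT.
have := powR_tangent n0 n2 (ltW s0).
have -> : (n + 2)%:R - (n + 3)%:R = -1 :> R by rewrite !natrD; ring.
rewrite mulN1r mulrN opprK => h.
have -> : (n.+1 + 2)%N = (n + 3)%N by rewrite addSnnS.
have -> : (n + 3)%:R `^ (- (1 + s)) = (n + 3)%:R `^ (- s) / (n + 3)%:R :> R.
  by rewrite opprD addrC powR_add// -powR_inv1// ltW.
have h3 : (n + 3)%:R `^ (- s) / (n + 3)%:R <=
    s^-1 * ((n + 2)%:R `^ (- s) - (n + 3)%:R `^ (- s)).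
  rewrite [leRHS]mulrC ler_pdivlMr// lerBrDl; apply: le_trans h.
  by rewrite mulrDr mulr1 lerD2l mulrAC -mulrA.
apply: le_trans (lerD IH h3) _.
by rewrite -mulrDr subrKA.
Qed.

Lemma powR_eventually_ge s (c : R) : 0 < s ->
  exists t0 : nat, forall t, (t0 <= t)%N -> c <= (t + 3)%:R `^ s.
Proof.
move=> s0; pose a := (`|c| + 1) `^ s^-1.
exists (Num.truncn a).+1 => t tt.
have c0 : 0 < `|c| + 1 by rewrite ltr_wpDl.
apply: (@le_trans _ _ (a `^ s)).
  rewrite /a -powRrM mulVf ?gt_eqF// powRr1 ?(ltW c0)//.
  by rewrite (le_trans (ler_norm _))// lerDl.
apply: ge0_ler_powR; rewrite ?nnegrE ?powR_ge0 ?(ltW s0)//.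
apply: le_trans (ltW (truncnS_gt a)) _.
by rewrite ler_nat (leq_trans tt)// leq_addr.
Qed.

Lemma powR_le1 (t : nat) s : 0 <= s -> (t + 3)%:R `^ (- s) <= 1 :> R.
Proof.
move=> s0; rewrite -[leRHS](powRr0 (t + 3)%:R); apply: ler_powR; last by rewrite oppr_le0.
by rewrite ler1n addn_gt0 orbT.
Qed.

Lemma powR_homo (t : nat) s q : s <= q -> (t + 3)%:R `^ s <= (t + 3)%:R `^ q :> R.
Proof. by move=> sq; apply: ler_powR => //; rewrite ler1n addn_gt0 orbT. Qed.

Lemma eventually_le_all (Phi p : nat -> R) (C : R) (t0 : nat) :
  (forall t, 0 < p t) -> (forall t, (t0 <= t)%N -> Phi t <= C * p t) ->
  exists2 C' : R, 0 <= C' & forall t, Phi t <= C' * p t.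
Proof.
move=> p0; elim: t0 => [|t0 IH] h.
  exists `|C| => // t; apply: le_trans (h t isT) _.
  by rewrite ler_wpM2r ?ler_norm ?(ltW (p0 t)).
exists (`|C| + \sum_(s < t0.+1) `|Phi s / p s|).
  by rewrite addr_ge0// sumr_ge0.
move=> t; case: (ltnP t0 t) => tt.
  apply: le_trans (h t tt) _; rewrite ler_wpM2r ?(ltW (p0 t))//.
  by rewrite (le_trans (ler_norm _))// lerDl sumr_ge0.
rewrite -ler_pdivrMr// (le_trans (ler_norm _))//.
rewrite -ltnS in tt; rewrite (bigD1 (Ordinal tt))//= addrCA lerDl.
by rewrite addr_ge0// sumr_ge0.
Qed.

(** A maximum principle: once [K * b <= c], the forcing gives back at most what the contraction
    removes at level [M], so a bound of the initial segment persists. *)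
Lemma recursion_bounded (Phi a b : nat -> R) (c K : R) (t0 : nat) :
  0 <= K ->
  (forall t, (t0 <= t)%N -> 0 <= a t /\ c * a t <= 1) ->
  (forall t, (t0 <= t)%N -> K * b t <= c) ->
  (forall t M, (t0 <= t)%N -> 1 <= M -> (forall r, (r <= t)%N -> Phi r <= M) ->
     Phi t.+1 <= (1 - c * a t) * Phi t + a t * b t * (K * M)) ->
  exists2 M : R, 1 <= M & forall t, Phi t <= M.
Proof.
move=> K0 ha hb rec; exists (1 + \sum_(s < t0.+1) `|Phi s|).
  by rewrite lerDl sumr_ge0.
set M := 1 + _; have M1 : 1 <= M by rewrite lerDl sumr_ge0.
have init (r : nat) : (r <= t0)%N -> Phi r <= M.
  rewrite -ltnS => st; rewrite /M (bigD1 (Ordinal st))//= addrCA.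
  by rewrite (le_trans (ler_norm _))// lerDl addr_ge0// sumr_ge0.
suff : forall t r, (r <= t)%N -> Phi r <= M by move=> h t; exact: (h t).
elim=> [|t IH] r; first by rewrite leqn0 => /eqP ->; exact: init.
rewrite leq_eqVlt => /orP[/eqP ->|]; last by rewrite ltnS; exact: IH.
case: (leqP t.+1 t0) => tt; first exact: init.
rewrite ltnS in tt; apply: le_trans (rec t M tt M1 IH) _.
have [a0 a1] := ha t tt.
have h1 : (1 - c * a t) * Phi t <= (1 - c * a t) * M.
  by rewrite ler_wpM2l ?subr_ge0// IH.
have h2 : a t * b t * (K * M) <= a t * c * M.
  rewrite [leLHS](_ : _ = a t * (K * b t) * M); last by ring.
  by rewrite ler_wpM2r ?(le_trans _ M1)// ler_wpM2l// hb.
apply: le_trans (lerD h1 h2) _; rewrite le_eqVlt; apply/orP; left; apply/eqP; ring.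
Qed.

(** The power loses the fraction [q / (t + 3)] per step at most, which half of the contraction
    [c * a] covers; the other half absorbs the forcing once [C >= 2 * K / c]. *)
Lemma recursion_rate (Phi a : nat -> R) (c K q : R) (t0 : nat) :
  0 < c -> 0 <= K -> 0 <= q -> (forall t, 0 <= Phi t) ->
  (forall t, (t0 <= t)%N -> [/\ 0 <= a t, c * a t <= 1 & q / (t + 3)%:R <= c * a t / 2]) ->
  (forall t, (t0 <= t)%N ->
     Phi t.+1 <= (1 - c * a t) * Phi t + a t * (K * (t + 3)%:R `^ (- q))) ->
  exists2 C : R, 0 <= C & forall t, Phi t <= C * (t + 3)%:R `^ (- q).
Proof.
move=> c0 K0 q0 Phi0 ha rec.
have p0 t : 0 < (t + 3)%:R `^ (- q) :> R by rewrite powR_gt0// ltr0n addn_gt0 orbT.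
(* The first summand absorbs the forcing, the second starts the induction at [t0]. *)
pose C := 2 * K / c + Phi t0 / (t0 + 3)%:R `^ (- q).
have C1 : 2 * K / c <= C by rewrite lerDl divr_ge0// ltW.
have C2 : Phi t0 <= C * (t0 + 3)%:R `^ (- q).
  rewrite -ler_pdivrMr// /C lerDr divr_ge0 ?mulr_ge0//; exact: ltW.
apply: (@eventually_le_all _ _ C t0) => // t.
elim: t => [|t IH].
  by rewrite leqn0 => /eqP t00; rewrite -[in X in Phi X]t00 -[in X in (X + 3)%:R]t00.
rewrite leq_eqVlt => /orP[/eqP <-//|].
rewrite ltnS => tt; have [a0 a1 a2] := ha t tt.
apply: le_trans (rec t tt) _.
have n3 : 0 < (t + 3)%:R :> R by rewrite ltr0n addn_gt0 orbT.
have n4 : 0 < (t.+1 + 3)%:R :> R by rewrite ltr0n addn_gt0 orbT.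
have := powR_tangent n3 n4 q0.
have -> : (t.+1 + 3)%:R - (t + 3)%:R = 1 :> R by rewrite !natrD -natr1; ring.
rewrite div1r => h.
have C0 : 0 <= C by apply: le_trans C1; rewrite divr_ge0// ?mulr_ge0// ltW.
set p := (t + 3)%:R `^ (- q) in h *.
have pp : 0 < p by exact: p0.
have h1 : C * (p * (1 - c * a t / 2)) <= C * (t.+1 + 3)%:R `^ (- q).
  rewrite ler_wpM2l//; apply: le_trans h; rewrite ler_pM2l// lerD2l lerN2.
  exact: a2.
apply: le_trans h1.
have h2 : (1 - c * a t) * Phi t <= (1 - c * a t) * (C * p).
  by rewrite ler_wpM2l ?subr_ge0// IH.
have h3 : K <= C * c / 2.
  move: C1; rewrite ler_pdivrMr// => C1'; rewrite ler_pdivlMr//; lra.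
have h4 : a t * (K * p) <= a t * (C * c / 2 * p).
  by rewrite ler_wpM2l// ler_wpM2r// ltW.
apply: le_trans (lerD h2 h4) _; rewrite le_eqVlt; by apply/orP; left; apply/eqP; field.
Qed.

End powers.

(** * Almost sure convergence from bounds in expectation *)

Section almost_sure.
Context {R : realType} {dT : measure_display} {T : measurableType dT}
  (mu : probability T R).

(** Exchanging sum and integral bounds the expectation of the whole series by [K], so the series is
    finite almost everywhere. *)
Lemma ae_summable (f : nat -> T -> R) (K : R) :
  (forall k, bmf (f k)) -> (forall k x, 0 <= f k x) ->
  (forall n, \sum_(0 <= k < n) \int[mu]_x f k x <= K) ->
  {ae mu, forall x, cvgn (series (fun k => f k x))}.
Proof.
move=> bf f0 fK.
have mf k : measurable_fun setT (fun x => (f k x)%:E).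
  by apply/measurable_EFinP; case: (bf k).
have f0' k x : setT x -> (0 <= (f k x)%:E)%E by rewrite lee_fin.
have RE k : (\int[mu]_x f k x)%:E = (\int[mu]_x (f k x)%:E)%E.
  rewrite /Rintegral fineK//; apply: integrable_fin_num => //.
  exact: (bmf_integrable (probability_ltoo mu) measurableT (bf k)).
pose S x := (\sum_(0 <= k <oo) (f k x)%:E)%E.
have S0 x : (0 <= S x)%E by apply: nneseries_ge0 => k _ _; rewrite lee_fin.
have mS : measurable_fun setT S.
  by apply: ge0_emeasurable_sum => // k x _ _; rewrite lee_fin.
have iS : mu.-integrable setT S.
  apply/integrableP; split => //.
  under eq_integral do rewrite gee0_abs//.
  rewrite integral_nneseries//; apply: (@le_lt_trans _ _ K%:E); last exact: ltry.
  apply: lime_le.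
    by apply: is_cvg_nneseries => k _ _; apply: integral_ge0 => x _; rewrite lee_fin.
  near=> n; under eq_bigr do rewrite -RE.
  by rewrite sumEFin lee_fin; exact: fK.
have := integrable_ae measurableT iS.
apply: filterS => x /(_ I) Sfin.
apply: nondecreasing_is_cvgn.
  apply/nondecreasing_seqP => n; rewrite /series/= big_nat_recr//= lerDl; exact: f0.
exists (fine (S x)) => _ [n _ <-]; rewrite /series/=.
rewrite -lee_fin fineK// -sumEFin; apply: nneseries_lim_ge => k _ _.
by rewrite lee_fin.
Unshelve. all: by end_near. Qed.

(* The limit exists because the increments are summable; it is identified along
   a subsequence whose expectations are summable. *)
Lemma ae_cvg0 (g : nat -> T -> R) (K : R) :
  (forall t, bmf (g t)) -> (forall t x, 0 <= g t x) ->
  (forall n, \sum_(0 <= t < n) \int[mu]_x `|g t.+1 x - g t x| <= K) ->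
  (fun t => \int[mu]_x g t x) @ \oo --> 0 ->
  {ae mu, forall x, (fun t => g t x) @ \oo --> 0}.
Proof.
move=> bg g0 gK Eg.
have ex k : exists t, (k <= t)%N /\ \int[mu]_x g t x <= 1 / 2 ^+ k.+1.
  have e0 : 0 < 1 / 2 ^+ k.+1 :> R by rewrite divr_gt0// exprn_gt0.
  move/cvgr0Pnorm_lt : Eg => /(_ _ e0) [N _ hN].
  exists (maxn k N); split; first exact: leq_maxl.
  apply: le_trans (ler_norm _) (ltW _); apply: hN => /=; exact: leq_maxr.
have [phi hphi] := choice ex.
have sub_sum n : \sum_(0 <= k < n) \int[mu]_x g (phi k) x <= 1.
  apply: (@le_trans _ _ (1 - 1 / 2 ^+ n)); last first.
    by rewrite gerBl divr_ge0// exprn_ge0.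
  elim: n => [|n IH]; first by rewrite big_geq// expr0 divr1 subrr.
  rewrite big_nat_recr//=; apply: le_trans (lerD IH (proj2 (hphi n))) _.
  rewrite exprS; have : 2 ^+ n != 0 :> R by rewrite expf_neq0.
  by move=> p0; rewrite le_eqVlt; apply/orP; left; apply/eqP; field.
have A1 := ae_summable (fun k => bmf_norm (bmfB (bg k.+1) (bg k)))
  (fun _ _ => normr_ge0 _) gK.
have A2 := ae_summable (fun k => bg (phi k)) (fun k => g0 (phi k)) sub_sum.
apply: filterS2 A1 A2 => x c1 c2.
have cg : cvgn (fun t => g t x).
  have /normed_cvg c3 : cvgn [normed series (telescope (fun t => g t x))].
    exact: c1.
  have : (fun t => g t x) = (fun t => g 0%N x + series (telescope (fun t => g t x)) t).
    by apply/funext => t; rewrite -eq_sum_telescope.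
  move=> ->; apply: is_cvgD => //; exact: is_cvg_cst.
have phioo : phi @ \oo --> \oo.
  move=> A [N _ hN]; exists N => // k /= Nk; apply: hN => /=.
  exact: leq_trans Nk (proj1 (hphi k)).
have l1 := cvg_comp _ _ phioo cg.
have l2 := cvg_series_cvg_0 c2.
have -> : 0 = limn (fun t => g t x) by exact: (cvg_unique _ l2 l1).
exact: cg.
Qed.

End almost_sure.

(** * Second moments of the iterates *)

Lemma sqr_sum_le (R : realDomainType) (d : nat) (F : 'I_d -> R) :
  (\sum_i `|F i|) ^+ 2 <= d%:R * \sum_i F i ^+ 2.
Proof.
have AM a b : `|a| * `|b| + `|a| * `|b| <= a ^+ 2 + b ^+ 2 :> R.
  rewrite -(real_normK (num_real a)) -(real_normK (num_real b)).
  by have := sqr_ge0 (`|a| - `|b|); rewrite sqrrB mulr2n; lra.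
have dbl : (\sum_i `|F i|) ^+ 2 + (\sum_i `|F i|) ^+ 2 <=
    d%:R * (\sum_i F i ^+ 2) + d%:R * (\sum_i F i ^+ 2).
  have E : (\sum_i `|F i|) ^+ 2 = \sum_i \sum_j `|F i| * `|F j|.
    by rewrite expr2 mulr_suml; apply: eq_bigr => i _; rewrite mulr_sumr.
  have C1 : \sum_i \sum_(j < d) F i ^+ 2 = d%:R * \sum_i F i ^+ 2.
    rewrite mulr_sumr; apply: eq_bigr => i _.
    by rewrite sumr_const card_ord mulr_natl.
  have C2 : \sum_(i < d) \sum_j F j ^+ 2 = d%:R * \sum_i F i ^+ 2.
    by rewrite exchange_big.
  rewrite -{1}C1 -C2 E -!big_split/=.
  by apply: ler_sum => i _; rewrite -!big_split/=; apply: ler_sum.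
lra.
Qed.

Section moments.
Context {R : realType} {d : nat} {dY : measure_display} {Y : measurableType dY}
  (P : R.-pker Y ~> Y) (dist : probability Y R)
  (dO : measure_display) (Omega : measurableType dO) (Prob : probability Omega R)
  (X : nat -> Omega -> Y) (mc : markov_chain Prob P X)
  (C rho : R) (C0 : 0 <= C) (rho0 : 0 <= rho) (rho1 : rho <= 1)
  (mix : forall (y : Y) (n : nat) (A : set Y), measurable A ->
       (`| kiter P n y A - dist A | <= (C * rho ^+ n)%:E)%E)
  (H : 'rV[R]_d -> Y -> 'rV[R]_d)
  (mH : forall w (i : 'I_d), measurable_fun setT (fun y => H w y 0 i))
  (nrm : 'rV[R]_d -> R) (nrmP : is_norm nrm)
  (kappa : R) (kappa0 : 0 <= kappa) (kappa1 : kappa < 1)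
  (contr : forall w w', nrm (mean_field dist H w - mean_field dist H w')
                  <= kappa * nrm (w - w'))
  (L : R) (L0 : 0 <= L)
  (HL : forall w w' y, nrm (H w y - H w' y) <= L * nrm (w - w'))
  (B : R) (B0 : 0 <= B) (HB : forall y, nrm (H 0 y) <= B)
  (wstar w0 : 'rV[R]_d) (fixp : mean_field dist H wstar = wstar)
  (alpha : nat -> R) (alpha0 : forall t, 0 <= alpha t)
  (alphaW : forall s t, (s <= t)%N -> alpha t <= alpha s)
  (K1 K2 : R) (K10 : 0 < K1) (K20 : 0 < K2)
  (nrmK : forall x, nrm x <= K1 * \sum_i `|x 0 i|)
  (coordK : forall (x : 'rV[R]_d) i, `|x 0 i| <= K2 * nrm x).

Let h := mean_field dist H.
Let w := sa_iter H X alpha w0.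
Let err t om := nrm (w t om - wstar).

(* [mean_iter] and [noise_iter] are [v] and [U] of the header. *)
Fixpoint mean_iter (t : nat) (om : Omega) : 'rV[R]_d :=
  match t with
  | 0 => w0 - wstar
  | t'.+1 => (1 - alpha t') *: mean_iter t' om + alpha t' *: (h (w t' om) - wstar)
  end.

Definition noise_iter t om := w t om - wstar - mean_iter t om.

Let U t (i : 'I_d) om := noise_iter t om 0 i.
(* Auxiliary functions and constants enter through defining equations, which keeps
   them opaque to unification. *)
Context (G : 'I_d -> 'rV[R]_d -> Y -> R)
  (GE : forall i x y, G i x y = H x y 0 i - h x 0 i).
Context (K3 : R) (K3E : K3 = L + L * nrm wstar + B + nrm wstar).
Context (Kg : R) (KgE : Kg = K2 * (K3 + 1)).
Context (KL : R) (KLE : KL = K2 * (L + 1)).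

Let n0 x : 0 <= nrm x. Proof. exact: nrm_ge0. Qed.
Let err0 t om : 0 <= err t om. Proof. exact: n0. Qed.
Let K30 : 0 <= K3. Proof. by rewrite K3E !addr_ge0 ?mulr_ge0. Qed.
Let Kg0 : 0 <= Kg. Proof. by rewrite KgE mulr_ge0 ?(ltW K20)// addr_ge0. Qed.
Let KL0 : 0 <= KL. Proof. by rewrite KLE mulr_ge0 ?(ltW K20)// addr_ge0. Qed.

(** * Growth and Lipschitz bounds for the field and its centred version *)

Lemma h_growth x : nrm (h x - wstar) <= kappa * nrm (x - wstar).
Proof. by rewrite -{1}fixp; exact: contr. Qed.

Lemma H_growth x y : nrm (H x y - wstar) <= K3 * (1 + nrm (x - wstar)).
Proof.
have -> : H x y - wstar = (H x y - H 0 y) + (H 0 y - wstar).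
  by rewrite addrA subrK.
apply: le_trans (ler_nrmD nrmP _ _) _.
have h1 := HL x 0 y; rewrite subr0 in h1.
have h2 := ler_nrmD nrmP (H 0 y) (- wstar); rewrite nrmN// in h2.
have h3 := HB y.
have h4 : nrm x <= nrm (x - wstar) + nrm wstar.
  by have := ler_nrmD nrmP (x - wstar) wstar; rewrite subrK.
have h5 : L * nrm x <= L * (nrm (x - wstar) + nrm wstar) by rewrite ler_wpM2l.
have e0 := n0 (x - wstar); have s0 := n0 wstar.
have h6 : 0 <= (L * nrm wstar + B + nrm wstar) * nrm (x - wstar).
  by rewrite mulr_ge0// !addr_ge0// mulr_ge0.
by rewrite K3E; move: L0 h1 h2 h3 h5 h6; lra.
Qed.

Lemma G_bound i x y : `|G i x y| <= Kg * (1 + nrm (x - wstar)).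
Proof.
have -> : G i x y = (H x y - wstar) 0 i - (h x - wstar) 0 i.
  by rewrite !GE !mxE; ring.
apply: le_trans (ler_normB _ _) _.
apply: le_trans (lerD (coordK _ _) (coordK _ _)) _.
rewrite -mulrDr KgE -mulrA ler_pM2l// mulrDl mul1r.
apply: lerD; first exact: H_growth.
apply: le_trans (h_growth _) _.
have : kappa * nrm (x - wstar) <= 1 * nrm (x - wstar) by rewrite ler_wpM2r// ltW.
by move=> h1; apply: le_trans h1 _; rewrite mul1r lerDr.
Qed.

Lemma G_lip i x x' y : `|G i x y - G i x' y| <= KL * nrm (x - x').
Proof.
have -> : G i x y - G i x' y = (H x y - H x' y) 0 i - (h x - h x') 0 i.
  by rewrite !GE !mxE; ring.
apply: le_trans (ler_normB _ _) _.
apply: le_trans (lerD (coordK _ _) (coordK _ _)) _.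
rewrite -mulrDr KLE -mulrA ler_pM2l// mulrDl mul1r.
apply: lerD; first exact: HL.
apply: le_trans (contr _ _) _.
by rewrite -[leRHS]mul1r ler_wpM2r// ltW.
Qed.

Lemma bmf_H x i : bmf (fun y => H x y 0 i).
Proof.
split; first exact: mH.
exists (K2 * (K3 * (1 + nrm (x - wstar))) + `|wstar 0 i|) => y.
have -> : H x y 0 i = (H x y - wstar) 0 i + wstar 0 i by rewrite !mxE subrK.
apply: le_trans (ler_normD _ _) _; rewrite lerD2r.
by apply: le_trans (coordK _ _) _; rewrite ler_pM2l// H_growth.
Qed.

Lemma bmf_G x i : bmf (G i x).
Proof.
rewrite (_ : G i x = fun y => H x y 0 i - h x 0 i); last exact/funext/GE.
by apply: bmfB; [exact: bmf_H|exact: bmf_cst].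
Qed.

Lemma G_mean i x : \int[dist]_y G i x y = 0.
Proof.
under eq_Rintegral do rewrite GE.
rewrite (bmf_RintegralB (probability_ltoo dist) measurableT (bmf_H x i) (bmf_cst _)).
by rewrite Rintegral_prob_cst /h /mean_field mxE subrr.
Qed.

Lemma nrm_l1 x x' : nrm (x - x') <= K1 * \sum_i `|x 0 i - x' 0 i|.
Proof.
apply: le_trans (nrmK _) _; rewrite ler_pM2l//.
by apply: ler_sum => i _; rewrite !mxE.
Qed.

Lemma iter_rec t om i : w t.+1 om 0 i =
  w t om 0 i + alpha t * (H (w t om) (X t.+1 om) 0 i - w t om 0 i).
Proof. by rewrite {1}/w /= !mxE. Qed.

Lemma mean_rec t om i : mean_iter t.+1 om 0 i =
  (1 - alpha t) * mean_iter t om 0 i + alpha t * (h (w t om) 0 i - wstar 0 i).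
Proof. by rewrite /= !mxE. Qed.

(** The iterate [w t] is a function of [X 1, ..., X t]. It sits inside [H] as a random parameter, so
    the step combines measurability in [y] with the Lipschitz bound in the parameter. *)
Lemma iter_adapted t i : measurable_fun
  (setT : set (g_sigma_algebraType (filtration_gen X t))) (fun om => w t om 0 i).
Proof.
elim: t i => [|t IH] i; first exact: measurable_cst.
have mw j := filtration_funS (leqnSn t) (IH j).
rewrite (_ : (fun om => _) = (fun om => w t om 0 i +
    alpha t * (H (w t om) (X t.+1 om) 0 i - w t om 0 i))); last first.
  by apply/funext => om; rewrite iter_rec.
apply: measurable_funD; first exact: mw.
apply: measurable_funM; first exact: measurable_cst.
apply: measurable_funB; last exact: mw.
apply: (@measurable_fun_lipschitz_comp R d _
  (g_sigma_algebraType (filtration_gen X t.+1))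
  (fun x om => H x (X t.+1 om) 0 i) (w t) (K2 * (L * K1))).
- by move=> x; exact: (chain_adapted_comp (mH x i)).
- move=> x x' om.
  have -> : H x (X t.+1 om) 0 i - H x' (X t.+1 om) 0 i =
    (H x (X t.+1 om) - H x' (X t.+1 om)) 0 i by rewrite !mxE.
  apply: le_trans (coordK _ _) _; rewrite -mulrA ler_pM2l//.
  apply: le_trans (HL _ _ _) _; rewrite -mulrA ler_wpM2l//; exact: nrm_l1.
- exact: mw.
Qed.

Lemma mean_adapted t i : measurable_fun
  (setT : set (g_sigma_algebraType (filtration_gen X t)))
  (fun om => mean_iter t om 0 i).
Proof.
elim: t i => [|t IH] i; first exact: measurable_cst.
rewrite (_ : (fun om => _) = (fun om => (1 - alpha t) * mean_iter t om 0 i +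
    alpha t * (h (w t om) 0 i - wstar 0 i))); last first.
  by apply/funext => om; rewrite mean_rec.
apply: (filtration_funS (leqnSn t)); apply: measurable_funD.
  by apply: measurable_funM; [exact: measurable_cst|exact: IH].
apply: measurable_funM; first exact: measurable_cst.
apply: measurable_funB; last exact: measurable_cst.
apply: (@measurable_fun_lipschitz_comp R d _
  (g_sigma_algebraType (filtration_gen X t))
  (fun x om => h x 0 i) (w t) (K2 * (kappa * K1))); last exact: iter_adapted.
  by move=> x; exact: measurable_cst.
move=> x x' om; have -> : h x 0 i - h x' 0 i = (h x - h x') 0 i by rewrite !mxE.
apply: le_trans (coordK _ _) _; rewrite -mulrA ler_pM2l//.
apply: le_trans (contr _ _) _; rewrite -mulrA ler_wpM2l//; exact: nrm_l1.
Qed.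

Lemma iter_increment t om :
  nrm (w t.+1 om - w t om) <= alpha t * ((K3 + 1) * (1 + err t om)).
Proof.
rewrite /w /= addrC addrA addNr add0r nrmZ// ger0_norm// ler_wpM2l//.
rewrite -/(w t om) (_ : _ - _ = (H (w t om) (X t.+1 om) - wstar) - (w t om - wstar));
  last by rewrite opprB addrA subrK.
apply: le_trans (ler_nrmD nrmP _ _) _; rewrite nrmN// mulrDl mul1r.
by apply: lerD; [exact: H_growth|rewrite /err lerDr].
Qed.

(** The bound depends on [t] but not on the sample, since [H] grows at most linearly, uniformly in
    [y]. This is what places the iterates in [bmf]. *)
Lemma err_bounded t : exists M, forall om, err t om <= M.
Proof.
elim: t => [|t [M hM]]; first by exists (nrm (w0 - wstar)).
exists (M + alpha t * ((K3 + 1) * (1 + M))) => om.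
rewrite /err (_ : _ - _ = (w t om - wstar) + (w t.+1 om - w t om)); last first.
  by rewrite [RHS]addrC addrA subrK.
apply: le_trans (ler_nrmD nrmP _ _) _; apply: lerD; first exact: hM.
apply: le_trans (iter_increment _ _) _; rewrite ler_wpM2l// ler_wpM2l ?addr_ge0//.
by rewrite lerD2l.
Qed.

Lemma mean_bounded t : exists M, forall om, nrm (mean_iter t om) <= M.
Proof.
elim: t => [|t [M hM]]; first by exists (nrm (w0 - wstar)).
have [N hN] := err_bounded t.
exists (`|1 - alpha t| * M + alpha t * (kappa * N)) => om /=.
apply: le_trans (ler_nrmD nrmP _ _) _; rewrite !nrmZ//; apply: lerD.
  by rewrite ler_wpM2l.
rewrite ger0_norm// ler_wpM2l//; apply: le_trans (h_growth _) _.
by rewrite ler_wpM2l//; exact: hN.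
Qed.

Lemma bmf_iter t i : bmf (fun om => w t om 0 i).
Proof.
have mm := filtration_fun mc (@iter_adapted t i); split => //.
have [M hM] := err_bounded t; exists (K2 * M + `|wstar 0 i|) => om.
have -> : w t om 0 i = (w t om - wstar) 0 i + wstar 0 i by rewrite !mxE subrK.
apply: le_trans (ler_normD _ _) _; rewrite lerD2r.
by apply: le_trans (coordK _ _) _; rewrite ler_pM2l//; exact: hM.
Qed.

Lemma bmf_mean_iter t i : bmf (fun om => mean_iter t om 0 i).
Proof.
have mm := filtration_fun mc (@mean_adapted t i); split => //.
have [M hM] := mean_bounded t; exists (K2 * M) => om.
by apply: le_trans (coordK _ _) _; rewrite ler_pM2l//; exact: hM.
Qed.

Lemma bmf_nrm (f : Omega -> 'rV[R]_d) : (forall i, bmf (fun om => f om 0 i)) ->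
  bmf (fun om => nrm (f om)).
Proof.
move=> bf; split.
  apply: (@measurable_fun_lipschitz_comp _ _ _ _ (fun x _ => nrm x) f K1) => //.
  - move=> x x' _; apply: le_trans (ler_nrm_dist nrmP _ _) _; exact: nrm_l1.
  - by move=> i; case: (bf i).
have [_ [M hM]] : bmf (fun om => \sum_i `|f om 0 i|).
  by apply: bmf_sum => i; exact: bmf_norm.
exists (K1 * M) => om; rewrite ger0_norm//; apply: le_trans (nrmK _) _.
by rewrite ler_pM2l//; apply: le_trans (ler_norm _) (hM om).
Qed.

Lemma noise_coordE t i : U t i = (fun om => w t om 0 i - wstar 0 i - mean_iter t om 0 i).
Proof. by apply/funext => om; rewrite /U /noise_iter !mxE. Qed.

Lemma bmf_noise t i : bmf (U t i).
Proof.
rewrite noise_coordE; apply: bmfB; last exact: bmf_mean_iter.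
by apply: bmfB; [exact: bmf_iter|exact: bmf_cst].
Qed.

Lemma noise_adapted t i : measurable_fun
  (setT : set (g_sigma_algebraType (filtration_gen X t))) (U t i).
Proof.
rewrite noise_coordE; apply: measurable_funB; last exact: mean_adapted.
by apply: measurable_funB; [exact: iter_adapted|exact: measurable_cst].
Qed.

Lemma bmf_err t : bmf (err t).
Proof.
apply: bmf_nrm => i; under eq_fun do rewrite !mxE.
by apply: bmfB; [exact: bmf_iter|exact: bmf_cst].
Qed.

(** A common majorant of [1 + err] and of every noise coordinate, so that all estimates reduce to
    second moments of one quantity. *)
Context (xi : nat -> Omega -> R)
  (xiE : forall t om, xi t om = 1 + err t om + \sum_i `|U t i om|).

Lemma bmf_xi t : bmf (xi t).
Proof.
rewrite (_ : xi t = fun om => 1 + err t om + \sum_i `|U t i om|); last exact/funext/xiE.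
apply: bmfD; first by apply: bmfD; [exact: bmf_cst|exact: bmf_err].
by apply: bmf_sum => i; apply: bmf_norm; exact: bmf_noise.
Qed.

Let xi0 t om : 0 <= xi t om.
Proof. by rewrite xiE !addr_ge0// sumr_ge0. Qed.

Let err_xi t om : 1 + err t om <= xi t om.
Proof. by rewrite xiE lerDl sumr_ge0. Qed.

Let noise_xi t i om : `|U t i om| <= xi t om.
Proof.
rewrite xiE (bigD1 i)//= addrCA lerDl.
by rewrite !addr_ge0// sumr_ge0.
Qed.

(** * Increments, correlation and second moment of the noise part *)

Lemma noise_rec t i om : U t.+1 i om =
  (1 - alpha t) * U t i om + alpha t * G i (w t om) (X t.+1 om).
Proof. by rewrite !noise_coordE GE iter_rec mean_rec; ring. Qed.

Context (K5 : R) (K5E : K5 = Kg + K3 + 1).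
Let K50 : 0 <= K5. Proof. by rewrite K5E !addr_ge0. Qed.

Lemma noise_increment t i om :
  `|U t.+1 i om - U t i om| <= alpha t * (K5 * xi t om).
Proof.
rewrite noise_rec (_ : _ - _ = alpha t * (G i (w t om) (X t.+1 om) - U t i om)); last by ring.
rewrite normrM ger0_norm// ler_wpM2l//; apply: le_trans (ler_normB _ _) _.
have h1 : Kg * (1 + err t om) <= Kg * xi t om by rewrite ler_wpM2l.
have h2 := G_bound i (w t om) (X t.+1 om); have h3 := noise_xi t i om.
have h4 : 0 <= K3 * xi t om by rewrite mulr_ge0.
rewrite K5E !mulrDl mul1r; move: h1 h2 h3 h4; rewrite -/(err t om); lra.
Qed.

Lemma iter_increment_xi t om :
  nrm (w t.+1 om - w t om) <= alpha t * (K5 * xi t om).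
Proof.
apply: le_trans (iter_increment _ _) _; rewrite ler_wpM2l//.
apply: ler_pM => //; rewrite ?addr_ge0// K5E.
by rewrite -addrA lerDr.
Qed.

(** The price of freezing the process for [tau] steps; the rates decrease, so [alpha s] bounds all
    of them in the window. *)
Lemma window_increment s tau i om :
  nrm (w (s + tau)%N om - w s om) <= alpha s * (K5 * \sum_(r < tau) xi (s + r)%N om) /\
  `|U (s + tau)%N i om - U s i om| <= alpha s * (K5 * \sum_(r < tau) xi (s + r)%N om).
Proof.
elim: tau => [|tau [IH1 IH2]].
  by rewrite addn0 !subrr nrm0// normr0 big_ord0 !mulr0.
rewrite big_ord_recr/= addnS !mulrDr.
have a_le : alpha (s + tau)%N * (K5 * xi (s + tau)%N om) <=
    alpha s * (K5 * xi (s + tau)%N om).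
  by rewrite ler_wpM2r ?mulr_ge0// alphaW// leq_addr.
split.
  rewrite (_ : _ - _ = (w (s + tau)%N om - w s om) +
      (w (s + tau).+1 om - w (s + tau)%N om)); last by rewrite [RHS]addrC addrA subrK.
  apply: le_trans (ler_nrmD nrmP _ _) _; apply: lerD => //.
  exact: le_trans (iter_increment_xi _ _) a_le.
rewrite (_ : _ - _ = (U (s + tau)%N i om - U s i om) +
    (U (s + tau).+1 i om - U (s + tau)%N i om)); last by ring.
apply: le_trans (ler_normD _ _) _; apply: lerD => //.
exact: le_trans (noise_increment _ _ _) a_le.
Qed.

Let Plt : (Prob setT < +oo)%E. Proof. exact: probability_ltoo. Qed.

Lemma Rintegral_xiM r t M : \int[Prob]_om (xi r om ^+ 2) <= M ->
  \int[Prob]_om (xi t om ^+ 2) <= M ->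
  \int[Prob]_om (xi r om * xi t om) <= M.
Proof.
move=> hr ht.
have br := bmfX 2 (bmf_xi r); have bt := bmfX 2 (bmf_xi t).
apply: (@le_trans _ _ (\int[Prob]_om (2^-1 * (xi r om ^+ 2 + xi t om ^+ 2)))).
  apply: (bmf_le_Rintegral Plt measurableT).
  - by apply: bmfM; exact: bmf_xi.
  - by apply: bmfZ; exact: bmfD.
  - by move=> om _; have := sqr_ge0 (xi r om - xi t om); rewrite sqrrB; lra.
rewrite (bmf_RintegralZ Plt measurableT); last exact: bmfD.
rewrite (bmf_RintegralD Plt measurableT)//; lra.
Qed.

Context (K7 : R) (K7E : K7 = (KL + Kg) * K5).
Let K70 : 0 <= K7. Proof. by rewrite K7E mulr_ge0// addr_ge0. Qed.
Context (K6 : R) (K6E : K6 = 2 * K7 + 2 * C * Kg).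
Let K60 : 0 <= K6. Proof. by rewrite K6E addr_ge0 ?mulr_ge0. Qed.

Lemma bmf_noiseG s t i : bmf (fun om => G i (w s om) (X t om)).
Proof.
split.
  apply: (@measurable_fun_lipschitz_comp _ _ _ _
    (fun x om => G i x (X t om)) (w s) (KL * K1)) => //.
  - move=> x; apply: measurableT_comp; last exact: (chain_measurable mc).
    by case: (bmf_G x i).
  - move=> x x' om; apply: le_trans (G_lip _ _ _ _) _.
    by rewrite -mulrA ler_wpM2l//; exact: nrm_l1.
  - by move=> j; case: (bmf_iter s j).
have [M hM] := err_bounded s; exists (Kg * (1 + M)) => om.
by apply: le_trans (G_bound _ _ _) _; rewrite ler_wpM2l// lerD2l; exact: hM.
Qed.

Lemma noise_correlation s tau i M :
  (forall r, (r <= s + tau)%N -> \int[Prob]_om (xi r om ^+ 2) <= M) ->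
  `|\int[Prob]_om (U (s + tau)%N i om * G i (w (s + tau)%N om) (X (s + tau).+1 om))|
  <= K6 * (tau%:R * alpha s + rho ^+ tau) * M.
Proof.
set t := (s + tau)%N => hM.
have M0 : 0 <= M.
  apply: le_trans (hM 0%N isT); apply: Rintegral_ge0 => om _; exact: sqr_ge0.
have bUt := bmf_noise t i; have bUs := bmf_noise s i.
have bGt := bmf_noiseG t t.+1 i; have bGs := bmf_noiseG s t.+1 i.
pose F1 om := U t i om * G i (w t om) (X t.+1 om) - U s i om * G i (w s om) (X t.+1 om).
have bF1 : bmf F1 by apply: bmfB; exact: bmfM.
have bF2 : bmf (fun om => U s i om * G i (w s om) (X t.+1 om)) by exact: bmfM.
rewrite (_ : \int[Prob]_om _ = \int[Prob]_om F1 om +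
    \int[Prob]_om (U s i om * G i (w s om) (X t.+1 om))); last first.
  rewrite -(bmf_RintegralD Plt measurableT)//.
  by apply: eq_Rintegral => om _; rewrite /F1 subrK.
apply: le_trans (ler_normD _ _) _.
have h1 : `|\int[Prob]_om F1 om| <= 2 * K7 * (tau%:R * alpha s) * M.
  (* A majorant of [|F1|]: the window sum comes from the factor that changes, [xi t] or [xi s] from
     the factor that does not, and [K7] dominates both coefficients. *)
  pose F3 om := \sum_(r < tau) (alpha s * K7) *
    (xi t om * xi (s + r)%N om + xi s om * xi (s + r)%N om).
  have bxx r r' : bmf (fun om => xi r om * xi r' om) by apply: bmfM; exact: bmf_xi.
  have bF3 : bmf F3.
    by apply: bmf_sum => r; apply: bmfZ; apply: bmfD.
  apply: (@le_trans _ _ (\int[Prob]_om F3 om)).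
    apply: (bmf_ler_norm_Rintegral Plt measurableT) => // om _.
    have [w1 w2] := window_increment s tau i om.
    have -> : F1 om = U t i om * (G i (w t om) (X t.+1 om) - G i (w s om) (X t.+1 om))
      + (U t i om - U s i om) * G i (w s om) (X t.+1 om) by rewrite /F1; ring.
    apply: le_trans (ler_normD _ _) _; rewrite !normrM.
    set S := \sum_(r < tau) xi (s + r)%N om in w1 w2.
    have S0 : 0 <= S by rewrite sumr_ge0.
    have e1 : `|U t i om| * `|G i (w t om) (X t.+1 om) - G i (w s om) (X t.+1 om)| <=
        xi t om * (KL * (alpha s * (K5 * S))).
      apply: ler_pM => //; apply: le_trans (G_lip _ _ _ _) _.
      by rewrite ler_wpM2l.
    have e2 : `|U t i om - U s i om| * `|G i (w s om) (X t.+1 om)| <=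
        alpha s * (K5 * S) * (Kg * xi s om).
      apply: ler_pM => //; apply: le_trans (G_bound _ _ _) _.
      by rewrite ler_wpM2l//; exact: err_xi.
    apply: le_trans (lerD e1 e2) _.
    have -> : F3 om = alpha s * K7 * ((xi t om + xi s om) * S).
      rewrite /F3 -mulr_sumr; congr (_ * _); rewrite /S mulr_sumr.
      by apply: eq_bigr => r _; rewrite mulrDl.
    have q1 : 0 <= alpha s * K5 * S * (Kg * xi t om) by rewrite !mulr_ge0.
    have q2 : 0 <= alpha s * K5 * S * (KL * xi s om) by rewrite !mulr_ge0.
    have -> : alpha s * K7 * ((xi t om + xi s om) * S) =
      alpha s * K5 * S * (KL * xi t om) + alpha s * K5 * S * (Kg * xi s om) +
      (alpha s * K5 * S * (Kg * xi t om) + alpha s * K5 * S * (KL * xi s om)).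
      by rewrite K7E; ring.
    rewrite [leLHS](_ : _ = alpha s * K5 * S * (KL * xi t om) +
      alpha s * K5 * S * (Kg * xi s om)); last by ring.
    by rewrite lerDl addr_ge0.
  rewrite /F3 (bmf_Rintegral_sum Plt measurableT); last first.
    by move=> r; apply: bmfZ; apply: bmfD.
  apply: (@le_trans _ _ (tau%:R * (alpha s * K7 * (M + M)))); last first.
    by rewrite le_eqVlt; apply/orP; left; apply/eqP; ring.
  apply: ler_sum_cst => r.
  rewrite (bmf_RintegralZ Plt measurableT); last exact: bmfD.
  rewrite ler_wpM2l ?mulr_ge0// (bmf_RintegralD Plt measurableT)//.
  have sr : (s + r <= t)%N by rewrite leq_add2l ltnW.
  apply: lerD; apply: Rintegral_xiM; apply: hM => //.
  by rewrite leq_addr.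
have h2 : `|\int[Prob]_om (U s i om * G i (w s om) (X t.+1 om))| <=
    2 * C * Kg * rho ^+ tau * M.
  (* The new noise has index [s + (tau + 1)], one mixing step more than claimed; the surplus factor
     [rho <= 1] is dropped at the end. *)
  rewrite -addnS.
  have Kgn x x' : `|Kg * (1 + nrm (x - wstar)) - Kg * (1 + nrm (x' - wstar))| <=
      (KL * K1 + Kg * K1) * \sum_j `|x 0 j - x' 0 j|.
    rewrite -mulrBr normrM ger0_norm//.
    rewrite (_ : _ - _ = nrm (x - wstar) - nrm (x' - wstar)); last by ring.
    have e1 : `|nrm (x - wstar) - nrm (x' - wstar)| <= K1 * \sum_j `|x 0 j - x' 0 j|.
      apply: le_trans (ler_nrm_dist nrmP _ _) _.
      by rewrite opprB addrA subrK; exact: nrm_l1.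
    apply: (@le_trans _ _ (Kg * (K1 * \sum_j `|x 0 j - x' 0 j|))).
      by rewrite ler_wpM2l.
    by rewrite mulrDl mulrA lerDr !mulr_ge0 ?(ltW K10)// sumr_ge0.
  have Gn x x' y : `|G i x y - G i x' y| <=
      (KL * K1 + Kg * K1) * \sum_j `|x 0 j - x' 0 j|.
    apply: le_trans (G_lip _ _ _ _) _.
    apply: (@le_trans _ _ (KL * (K1 * \sum_j `|x 0 j - x' 0 j|))).
      by rewrite ler_wpM2l//; exact: nrm_l1.
    by rewrite mulrDl mulrA lerDl !mulr_ge0 ?(ltW K10)// sumr_ge0.
  have LL0 : 0 <= KL * K1 + Kg * K1 by rewrite addr_ge0// mulr_ge0// ltW.
  have bUb : exists M, forall om, `|U s i om| <= M by case: bUs.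
  have bwb : exists M, forall om j, `|w s om 0 j| <= M.
    have [N hN] := err_bounded s.
    exists (K2 * (N + nrm wstar)) => om j; apply: le_trans (coordK _ _) _.
    rewrite ler_pM2l// -[w s om](subrK wstar).
    apply: le_trans (ler_nrmD nrmP _ _) _; rewrite lerD2r; exact: hN.
  apply: le_trans (mixing_parametric mc C0 rho0 mix LL0 (fun x => (bmf_G x i).1)
    (G_bound i) (G_mean i) Gn Kgn tau.+1 (@noise_adapted s i)
    (@iter_adapted s) bUb bwb) _.
  have e1 : \int[Prob]_om (`|U s i om| * (Kg * (1 + nrm (w s om - wstar)))) <= Kg * M.
    apply: (@le_trans _ _ (\int[Prob]_om (Kg * (xi s om * xi s om)))).
      apply: (bmf_le_Rintegral Plt measurableT).
      - apply: bmfM; first exact: bmf_norm.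
        by apply: bmfZ; apply: bmfD; [exact: bmf_cst|exact: bmf_err].
      - by apply: bmfZ; apply: bmfM; exact: bmf_xi.
      - move=> om _; rewrite mulrCA ler_wpM2l//; apply: ler_pM => //.
          by rewrite addr_ge0.
        exact: err_xi.
    rewrite (bmf_RintegralZ Plt measurableT); last by apply: bmfM; exact: bmf_xi.
    rewrite ler_wpM2l//; apply: Rintegral_xiM; apply: hM; exact: leq_addr.
  apply: (@le_trans _ _ (2 * (C * rho ^+ tau) * (Kg * M))); last first.
    by rewrite le_eqVlt; apply/orP; left; apply/eqP; ring.
  apply: ler_pM => //.
  - by rewrite !mulr_ge0// exprn_ge0.
  - apply: Rintegral_ge0 => om _; rewrite !mulr_ge0// addr_ge0//.
  - rewrite ler_pM2l// ler_wpM2l// exprS ler_piMl// exprn_ge0//.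
apply: le_trans (lerD h1 h2) _.
have q1 : 0 <= 2 * K7 * rho ^+ tau * M by rewrite !mulr_ge0// exprn_ge0.
have q2 : 0 <= 2 * C * Kg * (tau%:R * alpha s) * M by rewrite !mulr_ge0.
have -> : K6 * (tau%:R * alpha s + rho ^+ tau) * M =
  2 * K7 * (tau%:R * alpha s) * M + 2 * C * Kg * rho ^+ tau * M +
  (2 * K7 * rho ^+ tau * M + 2 * C * Kg * (tau%:R * alpha s) * M).
  by rewrite K6E; ring.
by rewrite lerDl addr_ge0.
Qed.

Context (K8 : R) (K8E : K8 = 2 * K6 + Kg ^+ 2).

(** The square expands exactly: its first term contracts by [(1 - alpha) ^ 2 <= 1 - alpha], the
    cross term is the correlation already bounded, and the squared noise carries [alpha ^ 2]. *)
Lemma noise_moment_step s tau i M : alpha (s + tau)%N <= 1 ->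
  (forall r, (r <= s + tau)%N -> \int[Prob]_om (xi r om ^+ 2) <= M) ->
  \int[Prob]_om (U (s + tau).+1 i om ^+ 2) <=
  (1 - alpha (s + tau)%N) * \int[Prob]_om (U (s + tau)%N i om ^+ 2) +
  alpha (s + tau)%N *
    ((tau%:R * alpha s + rho ^+ tau + alpha (s + tau)%N) * (K8 * M)).
Proof.
move=> a1 hM; have corr := noise_correlation i hM.
set t := (s + tau)%N in a1 hM corr *.
have M0 : 0 <= M.
  apply: le_trans (hM 0%N isT); apply: Rintegral_ge0 => om _; exact: sqr_ge0.
have bU := bmf_noise t i; have bG := bmf_noiseG t t.+1 i.
have bU2 := bmfX 2 bU; have bG2 := bmfX 2 bG; have bUG := bmfM bU bG.
have -> : \int[Prob]_om (U t.+1 i om ^+ 2) =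
    (1 - alpha t) ^+ 2 * \int[Prob]_om (U t i om ^+ 2) +
    (2 * (1 - alpha t) * alpha t *
      \int[Prob]_om (U t i om * G i (w t om) (X t.+1 om)) +
     alpha t ^+ 2 * \int[Prob]_om (G i (w t om) (X t.+1 om) ^+ 2)).
  rewrite -!(bmf_RintegralZ Plt measurableT)//.
  rewrite -!(bmf_RintegralD Plt measurableT)//; do ?[exact: bmfZ|apply: bmfD].
  by apply: eq_Rintegral => om _; rewrite noise_rec; ring.
have g2 : \int[Prob]_om (G i (w t om) (X t.+1 om) ^+ 2) <= Kg ^+ 2 * M.
  apply: (@le_trans _ _ (\int[Prob]_om (Kg ^+ 2 * xi t om ^+ 2))).
    apply: (bmf_le_Rintegral Plt measurableT) => //.
      by apply: bmfZ; apply: bmfX; exact: bmf_xi.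
    move=> om _; rewrite -exprMn -(real_normK (num_real (G _ _ _))).
    rewrite ler_pXn2r ?nnegrE ?mulr_ge0//; apply: le_trans (G_bound _ _ _) _.
    by rewrite ler_wpM2l//; exact: err_xi.
  rewrite (bmf_RintegralZ Plt measurableT); last by apply: bmfX; exact: bmf_xi.
  by rewrite ler_wpM2l ?sqr_ge0//; exact: hM.
set u := \int[Prob]_om (U t i om ^+ 2).
have u0 : 0 <= u by apply: Rintegral_ge0 => om _; exact: sqr_ge0.
set a := alpha t in a1 *; have a0 : 0 <= a by exact: alpha0.
set g := \int[Prob]_om (G i _ _ ^+ 2) in g2 *.
set cr := \int[Prob]_om (_ * _) in corr *.
set b := tau%:R * alpha s + rho ^+ tau in corr *.
have b0 : 0 <= b by rewrite addr_ge0 ?mulr_ge0// exprn_ge0.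
have e1 : (1 - a) ^+ 2 * u <= (1 - a) * u.
  by rewrite ler_wpM2r// expr2 ler_piMl ?subr_ge0// lerBlDr lerDl.
have e2 : 2 * (1 - a) * a * cr <= 2 * a * (K6 * b * M).
  rewrite [leLHS](_ : _ = 2 * a * ((1 - a) * cr)); last by ring.
  rewrite ler_wpM2l ?mulr_ge0//; apply: le_trans (ler_norm _) _.
  rewrite normrM ger0_norm ?subr_ge0//; apply: le_trans corr.
  by rewrite ler_piMl// lerBlDr lerDl.
have e3 : a ^+ 2 * g <= a * (a * (Kg ^+ 2 * M)).
  by rewrite expr2 -mulrA !ler_wpM2l.
have q1 : 0 <= a * (a * (2 * K6 * M)) by rewrite !mulr_ge0.
have q2 : 0 <= a * (b * (Kg ^+ 2 * M)) by rewrite !mulr_ge0// sqr_ge0.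
have -> : a * ((b + a) * (K8 * M)) = 2 * a * (K6 * b * M) + a * (a * (Kg ^+ 2 * M)) +
  (a * (a * (2 * K6 * M)) + a * (b * (Kg ^+ 2 * M))) by rewrite K8E; ring.
lra.
Qed.

(** * The Lyapunov function and its recursion *)

Context (c : R) (cE : c = 1 - kappa).
Let c0 : 0 < c. Proof. by rewrite cE subr_gt0. Qed.
Context (Kz : R) (KzE : Kz = K1 ^+ 2 * d%:R / c).
Let Kz0 : 0 <= Kz.
Proof. by rewrite KzE divr_ge0 ?(ltW c0)// mulr_ge0// sqr_ge0. Qed.

Lemma nrm_noise_sqr t om :
  nrm (noise_iter t om) ^+ 2 <= K1 ^+ 2 * d%:R * \sum_i U t i om ^+ 2.
Proof.
apply: (@le_trans _ _ ((K1 * \sum_i `|U t i om|) ^+ 2)).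
  by rewrite ler_pXn2r ?nnegrE// mulr_ge0 ?(ltW K10)// sumr_ge0.
by rewrite exprMn -mulrA ler_wpM2l ?sqr_ge0//; exact: sqr_sum_le.
Qed.

(** The contraction acts on [w - wstar = v + U]: the share of [v] leaves the rate [c = 1 - kappa],
    that of [U] becomes forcing. Squaring by convexity needs no smoothness of the norm and costs the
    factor [1 / c] in [Kz]. *)
Lemma mean_step t om : alpha t <= 1 ->
  nrm (mean_iter t.+1 om) ^+ 2 <= (1 - c * alpha t) * nrm (mean_iter t om) ^+ 2 +
  alpha t * (Kz * \sum_i U t i om ^+ 2).
Proof.
move=> a1; have a0 := alpha0 t; set a := alpha t in a0 a1 *.
set y := nrm (mean_iter t om); set n := nrm (noise_iter t om).
have y0 : 0 <= y by exact: n0.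
have nn0 : 0 <= n by exact: n0.
have ca1 : c * a <= 1.
  by rewrite -[leRHS]mulr1 ler_pM// ?(ltW c0)// cE lerBlDr lerDl.
have errn : err t om <= y + n.
  rewrite /err (_ : _ - _ = mean_iter t om + noise_iter t om).
    exact: ler_nrmD.
  by rewrite /noise_iter [RHS]addrC subrK.
have y' : nrm (mean_iter t.+1 om) <= (1 - c * a) * y + a * (kappa * n).
  rewrite /=; apply: le_trans (ler_nrmD nrmP _ _) _; rewrite !nrmZ// -/a -/y.
  rewrite !ger0_norm ?subr_ge0//.
  have e1 : a * nrm (h (w t om) - wstar) <= a * (kappa * (y + n)).
    rewrite ler_wpM2l//; apply: le_trans (h_growth _) _.
    by rewrite ler_wpM2l.
  by rewrite cE; move: e1; lra.
(* Jensen: the bound is a convex combination of [y] and [kappa n / c]. *)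
have jen : ((1 - c * a) * y + a * (kappa * n)) ^+ 2 <=
    (1 - c * a) * y ^+ 2 + a * (kappa ^+ 2 * n ^+ 2 / c).
  have := mulr_ge0 (mulr_ge0 (mulr_ge0 (ltW c0) a0)
    (_ : 0 <= 1 - c * a)) (sqr_ge0 (y - kappa * n / c)).
  rewrite subr_ge0 => /(_ ca1) J; rewrite -subr_ge0.
  rewrite [leRHS](_ : _ = c * a * (1 - c * a) * (y - kappa * n / c) ^+ 2)//.
  by field; rewrite gt_eqF.
apply: (@le_trans _ _ (((1 - c * a) * y + a * (kappa * n)) ^+ 2)).
  by rewrite ler_pXn2r ?nnegrE// addr_ge0// ?mulr_ge0// subr_ge0.
apply: le_trans jen _; rewrite lerD2l ler_wpM2l//.
rewrite KzE [leRHS]mulrAC ler_pM2r ?invr_gt0//.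
apply: le_trans (nrm_noise_sqr t om).
by rewrite ler_piMl ?sqr_ge0// expr_le1// ltW.
Qed.

Context (lam : R) (lamE : lam = 2 * Kz + 1).
Let lam0 : 0 <= lam. Proof. by rewrite lamE addr_ge0 ?mulr_ge0. Qed.

(** The weight [lam] must outweigh the amount [Kz] of noise fed into the mean part: as [c <= 1], the
    value [2 * Kz + 1] gives [Kz <= lam * (1 - c / 2)]. *)
Definition lyap t : R := \int[Prob]_om (nrm (mean_iter t om) ^+ 2) +
  lam * \sum_i \int[Prob]_om (U t i om ^+ 2).

Lemma bmf_mean_sqr t : bmf (fun om => nrm (mean_iter t om) ^+ 2).
Proof. by apply: bmfX; apply: bmf_nrm => i; exact: bmf_mean_iter. Qed.

Lemma bmf_noise_sqr t : bmf (fun om => \sum_i U t i om ^+ 2).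
Proof. by apply: bmf_sum => i; apply: bmfX; exact: bmf_noise. Qed.

Lemma lyapE t : lyap t = \int[Prob]_om
  (nrm (mean_iter t om) ^+ 2 + lam * \sum_i U t i om ^+ 2).
Proof.
rewrite (bmf_RintegralD Plt measurableT); [|exact: bmf_mean_sqr|].
  rewrite (bmf_RintegralZ Plt measurableT); last exact: bmf_noise_sqr.
  rewrite (bmf_Rintegral_sum Plt measurableT)// => i.
  by apply: bmfX; exact: bmf_noise.
by apply: bmfZ; exact: bmf_noise_sqr.
Qed.

Lemma lyap_ge0 t : 0 <= lyap t.
Proof.
rewrite lyapE; apply: Rintegral_ge0 => om _.
by rewrite addr_ge0 ?sqr_ge0// mulr_ge0// sumr_ge0// => i _; exact: sqr_ge0.
Qed.

Context (Kx : R) (KxE : Kx = 3 * (1 + (K1 + 1) ^+ 2 * d%:R)).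

Lemma pointwise_xi t om : xi t om ^+ 2 <= Kx +
  Kx * (nrm (mean_iter t om) ^+ 2 + lam * \sum_i U t i om ^+ 2).
Proof.
set y := nrm (mean_iter t om); set S2 := \sum_i U t i om ^+ 2.
set S := \sum_i `|U t i om|.
have S20 : 0 <= S2 by rewrite sumr_ge0// => i _; exact: sqr_ge0.
have S0 : 0 <= S by rewrite sumr_ge0.
have y0 : 0 <= y by exact: n0.
have hS : S ^+ 2 <= d%:R * S2 by exact: sqr_sum_le.
have hxi : xi t om <= 1 + y + (K1 + 1) * S.
  have : err t om <= y + K1 * S.
    rewrite /err (_ : _ - _ = mean_iter t om + noise_iter t om); last first.
      by rewrite /noise_iter [RHS]addrC subrK.
    by apply: le_trans (ler_nrmD nrmP _ _) _; rewrite lerD2l; exact: nrmK.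
  by rewrite xiE -/S; lra.
set k := (K1 + 1) ^+ 2 * d%:R.
have k0 : 0 <= k by rewrite mulr_ge0// sqr_ge0.
apply: (@le_trans _ _ ((1 + y + (K1 + 1) * S) ^+ 2)).
  by rewrite ler_pXn2r ?nnegrE// !addr_ge0// mulr_ge0// addr_ge0// ltW.
apply: (@le_trans _ _ (3 * (1 + y ^+ 2 + ((K1 + 1) * S) ^+ 2))).
  have := sqr_ge0 (1 - y); have := sqr_ge0 (1 - (K1 + 1) * S).
  by have := sqr_ge0 (y - (K1 + 1) * S); lra.
have e1 : ((K1 + 1) * S) ^+ 2 <= k * S2.
  by rewrite exprMn /k -mulrA ler_wpM2l ?sqr_ge0.
have lam1 : 1 <= lam by rewrite lamE lerDr mulr_ge0.
have e2 : k * S2 <= k * (lam * S2) by rewrite ler_wpM2l// ler_peMl.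
have q1 : 0 <= k * y ^+ 2 by rewrite mulr_ge0// sqr_ge0.
have q2 : 0 <= lam * S2 by rewrite mulr_ge0.
rewrite KxE -/k; move: e1 e2 q1 q2 k0; lra.
Qed.

Lemma xi_moment t : \int[Prob]_om (xi t om ^+ 2) <= Kx * (1 + lyap t).
Proof.
have bb : bmf (fun om => nrm (mean_iter t om) ^+ 2 + lam * \sum_i U t i om ^+ 2).
  by apply: bmfD; [exact: bmf_mean_sqr|apply: bmfZ; exact: bmf_noise_sqr].
rewrite lyapE mulrDr mulr1 -(bmf_RintegralZ Plt measurableT)//.
rewrite -{1}(Rintegral_prob_cst Prob Kx) -(bmf_RintegralD Plt measurableT).
- apply: (bmf_le_Rintegral Plt measurableT).
  + by apply: bmfX; exact: bmf_xi.
  + by apply: bmfD; [exact: bmf_cst|exact: bmfZ].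
  + by move=> om _; exact: pointwise_xi.
- exact: bmf_cst.
- exact: bmfZ.
Qed.

(** There is no additive constant, unlike in [xi_moment], so decay of [lyap] passes to the error
    itself. *)
Lemma err_moment t : \int[Prob]_om (err t om ^+ 2) <=
  (2 + 2 * (K1 ^+ 2 * d%:R)) * lyap t.
Proof.
have bb : bmf (fun om => nrm (mean_iter t om) ^+ 2 + lam * \sum_i U t i om ^+ 2).
  by apply: bmfD; [exact: bmf_mean_sqr|apply: bmfZ; exact: bmf_noise_sqr].
rewrite lyapE -(bmf_RintegralZ Plt measurableT)//.
apply: (bmf_le_Rintegral Plt measurableT); [by apply: bmfX; exact: bmf_err|exact: bmfZ|].
move=> om _; have hn := nrm_noise_sqr t om.
set y := nrm (mean_iter t om); set S2 := \sum_i U t i om ^+ 2 in hn *.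
set n := nrm (noise_iter t om) in hn.
have S20 : 0 <= S2 by rewrite sumr_ge0// => i _; exact: sqr_ge0.
have errn : err t om <= y + n.
  rewrite /err (_ : _ - _ = mean_iter t om + noise_iter t om).
    exact: ler_nrmD.
  by rewrite /noise_iter [RHS]addrC subrK.
set k := K1 ^+ 2 * d%:R in hn *.
have k0 : 0 <= k by rewrite mulr_ge0// sqr_ge0.
have y0 : 0 <= y by exact: n0.
have nn0 : 0 <= n by exact: n0.
apply: (@le_trans _ _ ((y + n) ^+ 2)).
  by rewrite ler_pXn2r ?nnegrE// addr_ge0.
have lam1 : 1 <= lam by rewrite lamE lerDr mulr_ge0.
have e2 : k * S2 <= k * (lam * S2) by rewrite ler_wpM2l// ler_peMl.
have q1 : 0 <= k * y ^+ 2 by rewrite mulr_ge0// sqr_ge0.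
have q2 : 0 <= lam * S2 by rewrite mulr_ge0.
have := sqr_ge0 (y - n); move: e2 q1 q2 hn; lra.
Qed.

(** With the rate [c / 2] instead of [c], the noise part, which contracts at the full rate, keeps
    the margin [1 - c / 2 >= 1/2] to pay for its input to the mean part. *)
Lemma lyap_step s tau M : alpha (s + tau)%N <= 1 -> 1 <= M ->
  (forall r, (r <= s + tau)%N -> lyap r <= M) ->
  lyap (s + tau).+1 <= (1 - c / 2 * alpha (s + tau)%N) * lyap (s + tau)%N +
   alpha (s + tau)%N * (tau%:R * alpha s + rho ^+ tau + alpha (s + tau)%N) *
   (lam * d%:R * K8 * (Kx * 2) * M).
Proof.
move=> a1 M1 hM; have a0 := alpha0 (s + tau)%N.
have Kx0 : 0 <= Kx by rewrite KxE mulr_ge0// addr_ge0// mulr_ge0// sqr_ge0.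
(* [1 <= M] merges the additive constant of [xi_moment] into [2 * M]. *)
have hxi r : (r <= s + tau)%N -> \int[Prob]_om (xi r om ^+ 2) <= Kx * (2 * M).
  move=> /hM hr; apply: le_trans (xi_moment r) _; rewrite ler_wpM2l//; lra.
have nst i := noise_moment_step i a1 hxi.
set b := tau%:R * alpha s + rho ^+ tau + _ in nst *.
set t := (s + tau)%N in a0 a1 nst *.
rewrite {1 2}/lyap.
set z := \int[Prob]_om (nrm (mean_iter t om) ^+ 2).
set z' := \int[Prob]_om (nrm (mean_iter t.+1 om) ^+ 2).
set u := \sum_i \int[Prob]_om (U t i om ^+ 2).
set u' := \sum_i \int[Prob]_om (U t.+1 i om ^+ 2).
set a := alpha t in a0 a1 nst *.
have z0 : 0 <= z by apply: Rintegral_ge0 => om _; exact: sqr_ge0.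
have u0 : 0 <= u.
  by apply: sumr_ge0 => i _; apply: Rintegral_ge0 => om _; exact: sqr_ge0.
have hz : z' <= (1 - c * a) * z + a * (Kz * u).
  rewrite /u -(bmf_Rintegral_sum Plt measurableT); last first.
    by move=> i; apply: bmfX; exact: bmf_noise.
  rewrite mulrA -!(bmf_RintegralZ Plt measurableT);
    [|exact: bmf_mean_sqr|exact: bmf_noise_sqr].
  rewrite -(bmf_RintegralD Plt measurableT); last 2 first.
  - by apply: bmfZ; exact: bmf_mean_sqr.
  - by apply: bmfZ; exact: bmf_noise_sqr.
  apply: (bmf_le_Rintegral Plt measurableT).
  - exact: bmf_mean_sqr.
  - by apply: bmfD; apply: bmfZ; [exact: bmf_mean_sqr|exact: bmf_noise_sqr].
  - by move=> om _; rewrite -mulrA; exact: mean_step.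
have hu : u' <= (1 - a) * u + d%:R * (a * (b * (K8 * (Kx * (2 * M))))).
  rewrite /u mulr_sumr -lerBlDl -sumrB; apply: ler_sum_cst => i.
  by rewrite lerBlDl; exact: nst.
have hlu : lam * u' <= lam * ((1 - a) * u + d%:R * (a * (b * (K8 * (Kx * (2 * M)))))).
  by rewrite ler_wpM2l.
have c1 : c <= 1 by rewrite cE lerBlDr lerDl.
have e1 : (1 - c * a) * z <= (1 - c / 2 * a) * z.
  rewrite ler_wpM2r// lerD2l lerN2 ler_wpM2r//; move: c0; lra.
have e2 : a * (Kz * u) + lam * ((1 - a) * u) <= (1 - c / 2 * a) * (lam * u).
  have au0 : 0 <= a * u by rewrite mulr_ge0.
  have : 0 <= (lam * (1 - c / 2) - Kz) * (a * u).
    rewrite mulr_ge0// subr_ge0 lamE.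
    have : (2 * Kz + 1) * (1 / 2) <= (2 * Kz + 1) * (1 - c / 2).
      by rewrite -lamE ler_wpM2l//; move: c1; lra.
    lra.
  move=> q; rewrite -subr_ge0.
  by rewrite [leRHS](_ : _ = (lam * (1 - c / 2) - Kz) * (a * u))//; ring.
have -> : a * b * (lam * d%:R * K8 * (Kx * 2) * M) =
  lam * (d%:R * (a * (b * (K8 * (Kx * (2 * M)))))) by ring.
rewrite [lam * (_ + _)]mulrDr in hlu; rewrite mulrDr.
move: hz hlu e1 e2; lra.
Qed.

End moments.

(** * Convergence rates *)

Section rates.
Context {R : realType}.

Lemma lrateE (Ca nu : R) t : lrate Ca nu t = Ca * (t + 3)%:R `^ (- nu).
Proof.
by rewrite /lrate !powR_expR ?ltr0n ?addn_gt0 ?orbT// mulNr expRN.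
Qed.

Lemma ln_le_powR (y eta : R) : 0 < y -> 0 < eta -> ln y <= eta^-1 * y `^ eta.
Proof.
move=> y0 e0; rewrite mulrC ler_pdivlMr// powR_expR// mulrC.
by apply: le_trans (expR_ge1Dx _); rewrite lerDr.
Qed.

Lemma mixing_window (Ca nu q rho : R) : 0 < Ca -> nu <= 1 -> 0 < q < nu ->
  0 < rho < 1 -> exists (K : R) (t0 : nat), 0 <= K /\
  forall t, (t0 <= t)%N -> exists2 tau, (tau <= t)%N &
    tau%:R * lrate Ca nu (t - tau)%N + rho ^+ tau + lrate Ca nu t <=
    K * (t + 3)%:R `^ (- q).
Proof.
move=> Ca0 nu1 /andP[q0 qnu] /andP[rho0 rho1].
(* Chosen so that [rho] to the power [A * ln y] equals [1 / y]. *)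
pose A := - (ln rho)^-1.
have lnrho : ln rho < 0 by rewrite ln_lt0// rho0.
have A0 : 0 < A by rewrite oppr_gt0 invr_lt0.
pose eta := nu - q; have eta0 : 0 < eta by rewrite subr_gt0.
(* [C1] bounds [tau] by a multiple of [y ^ eta], for the rate; [C2] by a multiple of the square root
   of [y], which yields [2 * tau <= y]. *)
pose C1 := A * eta^-1 + 1; pose C2 := A * (2^-1)^-1 + 1.
have C10 : 0 <= C1 by rewrite addr_ge0 ?mulr_ge0 ?invr_ge0 ?(ltW A0) ?(ltW eta0).
have C20 : 0 <= C2 by rewrite addr_ge0 ?mulr_ge0 ?invr_ge0 ?(ltW A0).
have half0 : 0 < 2^-1 :> R by rewrite invr_gt0.
have [t1 ht1] := powR_eventually_ge (2 * C2) half0.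
exists (2 * C1 * Ca + 1 + Ca), (maxn t1 3); split.
  by rewrite !addr_ge0 ?mulr_ge0 ?(ltW Ca0).
move=> t; rewrite geq_max => /andP[tt1 t3].
set y := (t + 3)%:R : R.
have y1 : 1 <= y by rewrite ler1n addn_gt0 orbT.
have y0 : 0 < y by apply: lt_le_trans y1.
have lny : 0 <= ln y by exact: ln_ge0.
pose tau := (Num.truncn (A * ln y)).+1.
have tau_ge : A * ln y <= tau%:R by apply: ltW; exact: truncnS_gt.
have tau_le : tau%:R <= A * ln y + 1.
  rewrite -natr1 lerD2r.
  have /truncn_itv/andP[] // : 0 <= A * ln y by rewrite mulr_ge0// ltW.
have tauP e : 0 < e -> tau%:R <= (A * e^-1 + 1) * y `^ e.
  move=> e0; apply: le_trans tau_le _; rewrite mulrDl mul1r; apply: lerD.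
    by rewrite -mulrA ler_pM2l//; exact: ln_le_powR.
  by rewrite -[leLHS](powRr0 y); apply: ler_powR => //; exact: ltW.
have tau2 : 2 * tau%:R <= y.
  apply: (@le_trans _ _ (y `^ 2^-1 * y `^ 2^-1)).
    apply: (@le_trans _ _ (2 * (C2 * y `^ 2^-1))).
      by rewrite ler_pM2l//; exact: tauP.
    by rewrite mulrA ler_wpM2r ?powR_ge0// ht1.
  rewrite -powR_add// (_ : 2^-1 + 2^-1 = 1); last by field.
  by rewrite powRr1// ltW.
have taut : (tau <= t)%N.
  rewrite -(ler_nat R); move: tau2; rewrite /y natrD.
  have : 3 <= t%:R :> R by rewrite (ler_nat R 3 t).
  lra.
exists tau => //.
have ge_half : y / 2 <= (t - tau + 3)%:R.
  rewrite natrD natrB//; move: tau2; rewrite /y natrD; lra.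
have p0 e : 0 <= y `^ e by exact: powR_ge0.
have a1 : lrate Ca nu (t - tau)%N <= 2 * Ca * y `^ (- nu).
  have nu0 : 0 < nu by apply: lt_trans qnu.
  rewrite /lrate ler_pdivrMr; last by rewrite powR_gt0// ltr0n addn_gt0 orbT.
  apply: (@le_trans _ _ (2 * Ca * y `^ (- nu) * (y / 2) `^ nu)); last first.
    rewrite ler_wpM2l ?mulr_ge0 ?(ltW Ca0)//.
    by apply: ge0_ler_powR; rewrite ?nnegrE ?divr_ge0 ?(ltW y0) ?(ltW nu0).
  rewrite powRM ?(ltW y0)// ?invr_ge0// [X in _ <= X](_ : _ =
    Ca * (2 * 2^-1 `^ nu) * (y `^ (- nu) * y `^ nu)); last by ring.
  rewrite -powR_add// addNr powRr0 mulr1 ler_peMr ?(ltW Ca0)//.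
  rewrite mulrC -ler_pdivrMr// div1r; apply: ger1_powR => //.
  by rewrite half0/= invf_le1// ler1n.
have a2 : tau%:R * lrate Ca nu (t - tau)%N <= 2 * C1 * Ca * y `^ (- q).
  apply: (@le_trans _ _ (C1 * y `^ eta * (2 * Ca * y `^ (- nu)))).
    apply: ler_pM => //; last exact: tauP.
    by rewrite lrateE mulr_ge0 ?(ltW Ca0)// powR_ge0.
  rewrite [leLHS](_ : _ = 2 * C1 * Ca * (y `^ eta * y `^ (- nu))); last by ring.
  by rewrite -powR_add// (_ : eta - nu = - q)// /eta; ring.
have a3 : rho ^+ tau <= y `^ (- q).
  apply: (@le_trans _ _ (y `^ (-1))); last first.
    apply: ler_powR => //; rewrite lerN2; exact: ltW (lt_le_trans qnu nu1).
  rewrite -powR_mulrn ?(ltW rho0)// !powR_expR// ler_expR mulN1r.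
  apply: (@le_trans _ _ (A * ln y * ln rho)).
    by rewrite ler_wnM2r// ltW.
  rewrite /A mulNr mulNr mulrAC mulVf ?mul1r// lt_eqF//.
have a4 : lrate Ca nu t <= Ca * y `^ (- q).
  by rewrite lrateE ler_pM2l//; apply: powR_homo; rewrite lerN2 ltW.
rewrite [leRHS]mulrDl [(_ + 1) * _]mulrDl mul1r.
exact: lerD (lerD a2 a3) a4.
Qed.

Lemma cvg_natpowR0 (K s : R) : 0 < s ->
  ((fun t : nat => K * (t + 3)%:R `^ (- s)) : nat -> R) @ \oo --> (0 : R).
Proof.
move=> s0; apply/cvgr0Pnorm_lt => e e0.
have [t0 ht] := powR_eventually_ge (`|K| / e + 1) s0.
exists t0 => // t /= tt; have := ht t tt.
have p0 : 0 < (t + 3)%:R `^ s :> R by rewrite powR_gt0// ltr0n addn_gt0 orbT.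
rewrite powRN normrM [`|_^-1|]ger0_norm ?invr_ge0 ?(ltW p0)// => h.
rewrite ltr_pdivrMr// mulrC -ltr_pdivrMr//; apply: lt_le_trans h.
by rewrite ltrDl.
Qed.

(** If [delta * x < x ^ b], then [x ^ (1 - b)] is at most [1 / delta], and [x ^ b] is a fixed power
    of it. The application is to [x = ln t]. *)
Lemma powR_le_linear (b delta : R) : 0 < b < 1 -> 0 < delta ->
  exists2 K, 0 <= K & forall x, 0 <= x -> x `^ b <= delta * x + K.
Proof.
move=> /andP[b0 b1] d0.
exists (delta^-1 `^ (b / (1 - b))); first exact: powR_ge0.
move=> x x0; have [x00|xn0] := eqVneq x 0.
  by rewrite x00 powR0 ?gt_eqF// mulr0 add0r powR_ge0.
have xp : 0 < x by rewrite lt_neqAle eq_sym xn0.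
have [h|h] := leP (x `^ b) (delta * x).
  by apply: le_trans h _; rewrite lerDl powR_ge0.
apply: (@le_trans _ _ (delta^-1 `^ (b / (1 - b)))); last first.
  by rewrite lerDr mulr_ge0// ltW.
have b10 : 0 < 1 - b by rewrite subr_gt0.
have -> : x `^ b = (x `^ (1 - b)) `^ (b / (1 - b)).
  by rewrite -powRrM mulrC divfK// gt_eqF.
apply: ge0_ler_powR; rewrite ?nnegrE ?powR_ge0 ?invr_ge0 ?(ltW d0)//.
  by rewrite divr_ge0// ltW.
rewrite -[leRHS]mul1r ler_pdivlMr// mulrC.
have xb : 0 < x `^ b by exact: powR_gt0.
rewrite -(ler_pM2r xb) mul1r -mulrA -powR_add// subrK powRr1; exact: ltW.
Qed.

Lemma squeeze_cvg0 (f g : nat -> R) (K : R) : (forall t, 0 <= f t <= K * g t) ->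
  g @ \oo --> (0 : R) -> f @ \oo --> (0 : R).
Proof.
move=> fg g0; apply: (@squeeze_cvgr _ _ _ _ (fun=> 0) (fun t => K * g t)).
- by apply: nearW => t; exact: fg.
- exact: cvg_cst.
- by rewrite -(mulr0 K); apply: cvgMr.
Qed.

End rates.

(** * Decay of the second moment and the almost sure rate *)

Section convergence_rate.
Context {R : realType} {d : nat} {dY : measure_display} {Y : measurableType dY}
  (P : R.-pker Y ~> Y) (dist : probability Y R)
  (dO : measure_display) (Omega : measurableType dO) (Prob : probability Omega R)
  (X : nat -> Omega -> Y) (mc : markov_chain Prob P X)
  (C rho : R) (C0 : 0 <= C) (rho0 : 0 < rho) (rho1 : rho < 1)
  (mix : forall (y : Y) (n : nat) (A : set Y), measurable A ->
       (`| kiter P n y A - dist A | <= (C * rho ^+ n)%:E)%E)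
  (H : 'rV[R]_d -> Y -> 'rV[R]_d)
  (mH : forall w (i : 'I_d), measurable_fun setT (fun y => H w y 0 i))
  (nrm : 'rV[R]_d -> R) (nrmP : is_norm nrm)
  (kappa : R) (kappa0 : 0 <= kappa) (kappa1 : kappa < 1)
  (contr : forall w w', nrm (mean_field dist H w - mean_field dist H w')
                  <= kappa * nrm (w - w'))
  (L : R) (L0 : 0 <= L)
  (HL : forall w w' y, nrm (H w y - H w' y) <= L * nrm (w - w'))
  (B : R) (B0 : 0 <= B) (HB : forall y, nrm (H 0 y) <= B)
  (wstar w0 : 'rV[R]_d) (fixp : mean_field dist H wstar = wstar)
  (Ca nu : R) (Ca0 : 0 < Ca) (nu0 : 0 < nu) (nu1 : nu <= 1).

Let alpha := lrate Ca nu.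
Let w := sa_iter H X alpha w0.
Let err t om := nrm (w t om - wstar).
Let Plt : (Prob setT < +oo)%E. Proof. exact: probability_ltoo. Qed.

Lemma lrate_ge0 t : 0 <= alpha t.
Proof. by rewrite /alpha lrateE mulr_ge0 ?(ltW Ca0)// powR_ge0. Qed.

Lemma lrate_decr s t : (s <= t)%N -> alpha t <= alpha s.
Proof.
move=> st; rewrite /alpha /lrate ler_pM2l// lef_pV2 ?posrE ?powR_gt0 ?ltr0n ?addn_gt0 ?orbT//.
by apply: ge0_ler_powR; rewrite ?nnegrE ?(ltW nu0)// ler_nat leq_add2r.
Qed.

(** The alternative on [q] compares the contraction with [q / (t + 3)]: for [nu < 1] the step size
    eventually dominates, whereas for [nu = 1] it is itself of order [1 / (t + 3)] and supports only
    small [q]. *)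
Lemma moment_rate q : 0 < q < nu ->
  nu < 1 \/ q <= (1 - kappa) / 2 * Ca / 2 ->
  exists2 K, 0 <= K & forall t,
    \int[Prob]_om (err t om ^+ 2) <= K * (t + 3)%:R `^ (- q).
Proof.
move=> qnu qcase; have /andP[q0 qnu'] := qnu.
have [K1 K10 nrmK] := nrm_le_coord nrmP.
have [K2 K20 coordK] := coord_le_nrm nrmP.
have c20 : 0 < (1 - kappa) / 2 by rewrite divr_gt0// subr_gt0.
have c21 : (1 - kappa) / 2 <= 1 by rewrite ler_pdivrMr//; move: kappa0; lra.
have [Kw [tw [Kw0 window]]] := mixing_window Ca0 nu1 qnu (introT andP (conj rho0 rho1)).
have step := lyap_step (w0 := w0) mc C0 (ltW rho0) (ltW rho1) mix mH nrmP kappa0 kappa1 contr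
  L0 HL B0 HB fixp lrate_ge0 lrate_decr K10 K20 nrmK coordK
  (fun _ _ _ => erefl) erefl erefl erefl (fun _ _ => erefl) erefl erefl erefl
  erefl erefl erefl erefl erefl.
have mom := err_moment mc mH nrmP kappa0 kappa1 contr L0 HL B0 HB w0 fixp
  lrate_ge0 K10 K20 nrmK coordK erefl erefl erefl erefl.
have pos := lyap_ge0 mc mH nrmP kappa0 kappa1 contr L0 HL B0 HB w0 fixp
  lrate_ge0 K10 K20 nrmK coordK erefl erefl erefl erefl.
move: step mom pos; set Phi := lyap _ _ _ _ _ _ _ _ _.
move=> step mom pos.
(* The explicit constant is forgotten here; its sign is then unknown, hence [|Kq|] below. *)
have [Kq {}step] : exists Kq, forall s tau M, alpha (s + tau)%N <= 1 -> 1 <= M ->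
    (forall r, (r <= s + tau)%N -> Phi r <= M) ->
    Phi (s + tau).+1 <= (1 - (1 - kappa) / 2 * alpha (s + tau)%N) * Phi (s + tau)%N +
    alpha (s + tau)%N * (tau%:R * alpha s + rho ^+ tau + alpha (s + tau)%N) * (Kq * M).
  by eexists; exact: step.
have Kq' : 0 <= `|Kq| by [].
have {}step t tau M : (tau <= t)%N -> alpha t <= 1 -> 1 <= M ->
    (forall r, (r <= t)%N -> Phi r <= M) ->
    Phi t.+1 <= (1 - (1 - kappa) / 2 * alpha t) * Phi t +
    alpha t * (tau%:R * alpha (t - tau)%N + rho ^+ tau + alpha t) * (`|Kq| * M).
  move=> taut a1 M1 hM; have := @step (t - tau)%N tau M; rewrite subnK// => /(_ a1 M1 hM).
  move/le_trans; apply; rewrite lerD2l ler_wpM2l//.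
    exact: (mulr_ge0 (lrate_ge0 t) (addr_ge0 (addr_ge0 (mulr_ge0 (ler0n _ _)
      (lrate_ge0 _)) (exprn_ge0 _ (ltW rho0))) (lrate_ge0 t))).
  by rewrite ler_wpM2r ?ler_norm// (le_trans ler01).
have [ta hta] := powR_eventually_ge Ca nu0.
have a_le1 t : (ta <= t)%N -> alpha t <= 1.
  by move=> /hta h; rewrite /alpha /lrate ler_pdivrMr ?mul1r.
have p0 (t : nat) e : 0 < (t + 3)%:R `^ e :> R.
  by rewrite powR_gt0// ltr0n addn_gt0 orbT.
have [tb htb] := powR_eventually_ge (`|Kq| * Kw / ((1 - kappa) / 2)) q0.
have b_le t : (tb <= t)%N -> `|Kq| * (Kw * (t + 3)%:R `^ (- q)) <= (1 - kappa) / 2.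
  move=> /htb; rewrite ler_pdivrMr// => h.
  by rewrite mulrA powRN ler_pdivrMr// [leRHS]mulrC.
pose t1 := maxn tw (maxn ta tb).
have stepw t M : (t1 <= t)%N -> 1 <= M -> (forall r, (r <= t)%N -> Phi r <= M) ->
    Phi t.+1 <= (1 - (1 - kappa) / 2 * alpha t) * Phi t +
    alpha t * (Kw * (t + 3)%:R `^ (- q)) * (`|Kq| * M).
  rewrite !geq_max => /and3P[htw hta' _] M1 hM.
  have [tau taut htau] := window t htw.
  apply: le_trans (step t tau M taut (a_le1 t hta') M1 hM) _.
  rewrite lerD2l ler_wpM2r ?(mulr_ge0 Kq' (le_trans ler01 M1))//.
  by rewrite ler_wpM2l ?lrate_ge0.
have ca t : (t1 <= t)%N -> 0 <= alpha t /\ (1 - kappa) / 2 * alpha t <= 1.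
  rewrite !geq_max => /and3P[_ hta' _]; split; first exact: lrate_ge0.
  rewrite -[leRHS]mulr1; apply: ler_pM; rewrite ?(ltW c20) ?lrate_ge0//.
  exact: a_le1.
have [M M1 PhiM] := @recursion_bounded _ Phi alpha (fun t => Kw * (t + 3)%:R `^ (- q))
  ((1 - kappa) / 2) `|Kq| t1 Kq' ca
  (fun t h => b_le t (leq_trans (leq_trans (leq_maxr _ _) (leq_maxr _ _)) h)) stepw.
have [tc htc] : exists tc, forall t, (tc <= t)%N ->
    q / (t + 3)%:R <= (1 - kappa) / 2 * alpha t / 2.
  have nE (t : nat) : (t + 3)%:R^-1 = (t + 3)%:R `^ (- nu) * (t + 3)%:R `^ (- (1 - nu)) :> R.
    rewrite -powR_add ?ltr0n ?addn_gt0 ?orbT//.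
    by rewrite (_ : - nu - (1 - nu) = -1) ?powR_inv1//; ring.
  have aE t : (1 - kappa) / 2 * alpha t / 2 =
      (t + 3)%:R `^ (- nu) * ((1 - kappa) / 2 * Ca / 2).
    by rewrite /alpha lrateE; ring.
  have k0 : 0 < (1 - kappa) / 2 * Ca / 2 by rewrite divr_gt0// mulr_gt0.
  case: qcase => [nu_lt1|qle].
    have nu10 : 0 < 1 - nu by rewrite subr_gt0.
    have [tc htc] := powR_eventually_ge (q / ((1 - kappa) / 2 * Ca / 2)) nu10.
    exists tc => t /htc h; rewrite nE aE mulrCA ler_pM2l// powRN ler_pdivrMr//.
    by move: h; rewrite ler_pdivrMr// mulrC.
  exists 0%N => t _; rewrite nE aE mulrCA ler_pM2l//.
  apply: le_trans qle; rewrite ler_piMr ?(ltW q0)//.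
  by apply: powR_le1; rewrite subr_ge0.
have ca' t : (maxn t1 tc <= t)%N -> [/\ 0 <= alpha t, (1 - kappa) / 2 * alpha t <= 1 &
    q / (t + 3)%:R <= (1 - kappa) / 2 * alpha t / 2].
  by rewrite geq_max => /andP[/ca[? ?] /htc].
(* With [Phi <= M] known, the forcing is a fixed multiple of [alpha t * (t + 3) ^ (- q)]. *)
have rec t : (maxn t1 tc <= t)%N -> Phi t.+1 <=
    (1 - (1 - kappa) / 2 * alpha t) * Phi t +
    alpha t * (Kw * (`|Kq| * M) * (t + 3)%:R `^ (- q)).
  rewrite geq_max => /andP[tt1 _].
  apply: le_trans (stepw t M tt1 M1 (fun r _ => PhiM r)) _.
  by rewrite le_eqVlt; apply/orP; left; apply/eqP; ring.
have [K K0 PhiK] := recursion_rate c20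
  (mulr_ge0 Kw0 (mulr_ge0 Kq' (le_trans ler01 M1))) (ltW q0) pos ca' rec.
have k0 : 0 <= 2 + 2 * (K1 ^+ 2 * d%:R) :> R.
  by rewrite addr_ge0// mulr_ge0// mulr_ge0// sqr_ge0.
exists ((2 + 2 * (K1 ^+ 2 * d%:R)) * K); first exact: mulr_ge0.
by move=> t; apply: le_trans (mom t) _; rewrite -[leRHS]mulrA ler_wpM2l.
Qed.

Lemma err_increment : exists2 K, 0 <= K & forall t om,
  `|err t.+1 om - err t om| <= alpha t * (K * (1 + err t om)).
Proof.
have h := iter_increment X nrmP L0 HL B0 HB w0 lrate_ge0 erefl.
eexists; last first.
  move=> t om; apply: le_trans (ler_nrm_dist nrmP _ _) _.
  by rewrite opprB addrA subrK; exact: h.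
by rewrite !addr_ge0 ?mulr_ge0 ?nrm_ge0.
Qed.

Lemma err_bmf t : bmf (err t).
Proof.
have [K1 K10 nrmK] := nrm_le_coord nrmP.
have [K2 K20 coordK] := coord_le_nrm nrmP.
exact: (bmf_err mc mH nrmP L0 HL B0 HB w0 lrate_ge0 K10 K20 nrmK coordK erefl t).
Qed.

(* Young's inequality [2 x <= p^-1 x^2 + p] replaces the Cauchy-Schwarz bound on
   the first moment. *)
Lemma weighted_increment (P0 P1 a K p x x' : R) :
  0 <= P0 -> 0 <= a -> 0 <= K -> 0 < p <= 1 -> 0 <= x -> 0 <= x' ->
  P0 <= P1 -> P1 <= 2 * P0 ->
  `|x' - x| <= a * (K * (1 + x)) ->
  `|P1 * x' ^+ 2 - P0 * x ^+ 2| <=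
  (2 * P0 * (4 * a * K + 2 * (a * K) ^+ 2) / p + (P1 - P0)) * x ^+ 2 +
  2 * P0 * (2 * a * K * p + 2 * (a * K) ^+ 2).
Proof.
move=> P00 a0 K0 /andP[p0 p1] x0 x'0 P01 P12 dx.
set k := a * K; have k0 : 0 <= k by rewrite mulr_ge0.
have {}dx : `|x' - x| <= k * (1 + x) by rewrite /k -mulrA.
have pV1 : 1 <= p^-1 by rewrite invf_ge1.
have x2 : 0 <= x ^+ 2 by exact: sqr_ge0.
have young : 2 * x <= p^-1 * x ^+ 2 + p.
  have : 0 <= p^-1 * (x - p) ^+ 2 by rewrite mulr_ge0 ?sqr_ge0// invr_ge0 ltW.
  rewrite (_ : p^-1 * (x - p) ^+ 2 = p^-1 * x ^+ 2 - 2 * x + p); first by lra.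
  by field; rewrite gt_eqF.
have xp : x ^+ 2 <= p^-1 * x ^+ 2 by rewrite ler_peMl.
have dsq : `|x' ^+ 2 - x ^+ 2| <=
    (4 * k + 2 * k ^+ 2) / p * x ^+ 2 + (2 * k * p + 2 * k ^+ 2).
  rewrite subr_sqr normrM.
  have sx : `|x' + x| <= k * (1 + x) + 2 * x.
    rewrite ger0_norm ?addr_ge0//; move: dx; rewrite ler_norml; lra.
  apply: (@le_trans _ _ (k * (1 + x) * (k * (1 + x) + 2 * x))).
    exact: ler_pM.
  have e1 : k * ((1 + x) * (2 * x)) <= k * (4 * (p^-1 * x ^+ 2) + 2 * p).
    rewrite ler_wpM2l//; move: young xp; lra.
  have e2 : k ^+ 2 * (1 + x) ^+ 2 <= k ^+ 2 * (2 + 2 * (p^-1 * x ^+ 2)).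
    rewrite ler_wpM2l ?sqr_ge0//; have := sqr_ge0 (1 - x); move: xp; lra.
  have -> : k * (1 + x) * (k * (1 + x) + 2 * x) =
    k * ((1 + x) * (2 * x)) + k ^+ 2 * (1 + x) ^+ 2 by ring.
  apply: le_trans (lerD e1 e2) _.
  have q : 0 <= k * p by rewrite mulr_ge0// ltW.
  rewrite -subr_ge0 [leRHS](_ : _ = 0)//; by ring.
have -> : P1 * x' ^+ 2 - P0 * x ^+ 2 = P1 * (x' ^+ 2 - x ^+ 2) + (P1 - P0) * x ^+ 2.
  by ring.
apply: le_trans (ler_normD _ _) _; rewrite normrM (normrM (P1 - P0)).
rewrite (ger0_norm (le_trans P00 P01)) (ger0_norm x2) (@ger0_norm _ (P1 - P0)) ?subr_ge0//.
have e3 : P1 * `|x' ^+ 2 - x ^+ 2| <= 2 * P0 *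
    ((4 * k + 2 * k ^+ 2) / p * x ^+ 2 + (2 * k * p + 2 * k ^+ 2)).
  by apply: ler_pM => //; exact: le_trans P01.
apply: le_trans (lerD e3 (lexx _)) _.
rewrite -subr_ge0 [leRHS](_ : _ = 0)//; by rewrite /k; ring.
Qed.

(** A step of the iterate changes the weighted square by about [t ^ (zeta - nu - q / 2)] in mean,
    [t ^ (- q / 2)] being the typical error; the growth of the weight contributes
    [t ^ (zeta - 1 - q)]. The two upper bounds on [s] make both [O(t ^ (- 1 - s))], which is
    summable. *)
Lemma almost_sure_rate zeta q s : 0 <= zeta <= 1 -> 0 < q -> q / 2 <= nu -> 0 < s ->
  s <= nu + q / 2 - zeta - 1 -> s <= q - zeta ->
  (exists2 K, 0 <= K & forall t,
    \int[Prob]_om (err t om ^+ 2) <= K * (t + 3)%:R `^ (- q)) ->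
  {ae Prob, forall om,
    (fun t : nat => (t + 3)%:R `^ zeta * err t om ^+ 2) @ \oo --> 0}.
Proof.
move=> /andP[z0 z1] q0 qnu s0 s1 s2 [C1 C10 mom].
have [K K0 inc] := err_increment.
have e0 t om : 0 <= err t om by exact: nrm_ge0.
have be2 t := bmfX 2 (err_bmf t).
pose K' := 2 * Ca * (4 * K + 2 * (Ca * K ^+ 2)) * C1 + C1 +
  2 * Ca * (2 * K + 2 * (Ca * K ^+ 2)).
have incE t : \int[Prob]_om `|(t.+1 + 3)%:R `^ zeta * err t.+1 om ^+ 2 -
      (t + 3)%:R `^ zeta * err t om ^+ 2| <= K' * (t + 3)%:R `^ (- (1 + s)).
  set y := (t + 3)%:R : R; set P0 := y `^ zeta; set P1 := (t.+1 + 3)%:R `^ zeta.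
  have y1 : 1 <= y by rewrite ler1n addn_gt0 orbT.
  have y0 : 0 < y by apply: lt_le_trans y1.
  have y'E : (t.+1 + 3)%:R = y + 1 :> R by rewrite addSn -natr1.
  (* The parameter in Young's inequality is the typical size of the error, whose second moment is
     [O(p ^ 2)]. *)
  set p := y `^ (- (q / 2)); have p0 : 0 < p by exact: powR_gt0.
  have p1 : p <= 1 by apply: powR_le1; rewrite divr_ge0// ltW.
  have P00 : 0 <= P0 by exact: powR_ge0.
  have P01 : P0 <= P1.
    apply: ge0_ler_powR; rewrite ?nnegrE ?(ltW y0)// y'E ?addr_ge0 ?(ltW y0)//.
    by rewrite lerDl.
  (* Here [zeta <= 1] enters, through [(1 + 1/y) ^ zeta <= 1 + 1/y]. *)
  have P1le : P1 <= P0 * (1 + y^-1).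
    rewrite /P1 y'E (_ : y + 1 = y * (1 + y^-1)); last first.
      by rewrite mulrDr mulr1 divff ?gt_eqF.
    rewrite powRM ?(ltW y0)// ?addr_ge0 ?invr_ge0 ?(ltW y0)//.
    rewrite ler_wpM2l//; apply: ler1_powR => //.
    by rewrite lerDl invr_ge0 ltW.
  have yV1 : y^-1 <= 1 by rewrite invf_le1.
  have P12 : P1 <= 2 * P0.
    apply: le_trans P1le _; rewrite mulrC ler_wpM2r//; move: yV1; lra.
  set a := alpha t; have a0 : 0 <= a by exact: lrate_ge0.
  have aE : a = Ca * y `^ (- nu) by exact: lrateE.
  (* This uses [q / 2 <= nu]; it turns terms quadratic in [a] into multiples of [a * p]. *)
  have ap : a <= Ca * p.
    by rewrite aE ler_pM2l//; apply: ler_powR => //; rewrite lerN2.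
  pose A := 2 * P0 * (4 * a * K + 2 * (a * K) ^+ 2) / p + (P1 - P0).
  pose D := 2 * P0 * (2 * a * K * p + 2 * (a * K) ^+ 2).
  have A0 : 0 <= A.
    rewrite addr_ge0 ?subr_ge0// divr_ge0 ?(ltW p0)// mulr_ge0 ?mulr_ge0//.
    exact: addr_ge0 (mulr_ge0 (mulr_ge0 (ler0n _ 4) a0) K0) (mulr_ge0 (ler0n _ 2) (sqr_ge0 _)).
  apply: (@le_trans _ _ (\int[Prob]_om (A * err t om ^+ 2 + D))).
    apply: (bmf_le_Rintegral Plt measurableT).
    - by apply: bmf_norm; apply: bmfB; exact: bmfZ.
    - by apply: bmfD; [exact: bmfZ|exact: bmf_cst].
    - have pI : 0 < p <= 1 by rewrite p0.
      move=> om _; exact: (weighted_increment P00 a0 K0 pI (e0 _ _) (e0 _ _) P01 P12 (inc t om)).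
  rewrite (bmf_RintegralD Plt measurableT); [|exact: bmfZ|exact: bmf_cst].
  rewrite (bmf_RintegralZ Plt measurableT)// Rintegral_prob_cst.
  have pp : y `^ (- q) = p * p by rewrite /p -powR_add//; congr (_ `^ _); field.
  have m1 : A * \int[Prob]_om (err t om ^+ 2) <= A * (C1 * (p * p)).
    by rewrite ler_wpM2l// -pp; exact: mom.
  have t1 : P0 * (y `^ (- nu) * p) <= y `^ (- (1 + s)).
    rewrite /P0 /p -!powR_add//; apply: ler_powR => //; move: s1; lra.
  have t2 : (P1 - P0) * (p * p) <= y `^ (- (1 + s)).
    apply: (@le_trans _ _ (P0 * y^-1 * (p * p))).
      rewrite ler_wpM2r ?mulr_ge0 ?(ltW p0)//; move: P1le; rewrite mulrDr mulr1; lra.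
    rewrite -pp /P0 -powR_inv1 ?(ltW y0)// -!powR_add//.
    by apply: ler_powR => //; move: s2; lra.
  have t0 : 0 <= P0 * (y `^ (- nu) * p) by rewrite !mulr_ge0 ?powR_ge0// ltW.
  set v := P0 * (y `^ (- nu) * p) in t1 t0.
  have ak : (a * K) ^+ 2 <= a * p * (Ca * K ^+ 2).
    rewrite exprMn expr2 -[a * p * _]mulrA -[a * a * _]mulrA ler_wpM2l//.
    rewrite [leRHS](_ : _ = Ca * p * K ^+ 2); last by ring.
    by rewrite ler_wpM2r ?sqr_ge0.
  have ak2 : (a * K) ^+ 2 * p <= a * p * (Ca * K ^+ 2).
    by apply: le_trans ak; rewrite ler_piMr// sqr_ge0.
  have avE : P0 * (a * p) = Ca * v by rewrite /v aE; ring.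
  have B1 : A * (C1 * (p * p)) <=
      2 * Ca * (4 * K + 2 * (Ca * K ^+ 2)) * C1 * v + C1 * ((P1 - P0) * (p * p)).
    rewrite /A mulrDl; apply: lerD; last first.
      by rewrite le_eqVlt; apply/orP; left; apply/eqP; ring.
    rewrite [leLHS](_ : _ = 2 * C1 * (P0 * (4 * K * (a * p) + 2 * ((a * K) ^+ 2 * p))));
      last by field; rewrite gt_eqF.
    rewrite [leRHS](_ : _ = 2 * C1 * (P0 * (4 * K * (a * p) + 2 * (a * p * (Ca * K ^+ 2)))));
      last by rewrite [in RHS](_ : P0 * _ = (4 * K + 2 * (Ca * K ^+ 2)) * (P0 * (a * p)));
        [rewrite avE; ring|ring].
    by rewrite ler_wpM2l ?mulr_ge0// ler_wpM2l// lerD2l ler_pM2l.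
  have B2 : D <= 2 * Ca * (2 * K + 2 * (Ca * K ^+ 2)) * v.
    rewrite /D [leRHS](_ : _ = 2 * (P0 * (2 * K * (a * p) + 2 * (a * p * (Ca * K ^+ 2)))));
      last by rewrite [in RHS](_ : P0 * _ = (2 * K + 2 * (Ca * K ^+ 2)) * (P0 * (a * p)));
        [rewrite avE; ring|ring].
    rewrite [leLHS](_ : _ = 2 * (P0 * (2 * K * (a * p) + 2 * (a * K) ^+ 2))); last by ring.
    by rewrite ler_pM2l// ler_wpM2l// lerD2l ler_pM2l.
  apply: le_trans (lerD m1 (lexx _)) _; apply: le_trans (lerD B1 B2) _.
  set Q1 := 2 * Ca * (4 * K + 2 * (Ca * K ^+ 2)) * C1.
  set Q2 := 2 * Ca * (2 * K + 2 * (Ca * K ^+ 2)).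
  have Q10 : 0 <= Q1 by rewrite !mulr_ge0 ?addr_ge0 ?mulr_ge0 ?sqr_ge0 ?(ltW Ca0).
  have Q20 : 0 <= Q2 by rewrite !mulr_ge0 ?addr_ge0 ?mulr_ge0 ?sqr_ge0 ?(ltW Ca0).
  rewrite /K' -/Q1 -/Q2 [leRHS]mulrDl [(Q1 + C1) * _]mulrDl.
  exact: lerD (lerD (ler_wpM2l Q10 t1) (ler_wpM2l C10 t2)) (ler_wpM2l Q20 t1).
have [Ks hKs] := powR_sum_bounded s0.
have K'0 : 0 <= K'.
  by rewrite !addr_ge0 ?mulr_ge0 ?addr_ge0 ?mulr_ge0 ?sqr_ge0 ?(ltW Ca0).
apply: (@ae_cvg0 _ _ _ Prob _ (K' * Ks)).
- by move=> t; apply: bmfZ.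
- by move=> t om; rewrite mulr_ge0 ?powR_ge0 ?sqr_ge0.
- move=> n; apply: (@le_trans _ _ (\sum_(0 <= t < n) K' * (t + 3)%:R `^ (- (1 + s)))).
    by apply: ler_sum => t _; exact: incE.
  by rewrite -mulr_sumr ler_wpM2l.
- have qz : 0 < q - zeta by exact: lt_le_trans s2.
  apply: (@squeeze_cvg0 _ _ (fun t => C1 * (t + 3)%:R `^ (- (q - zeta))) 1); last first.
    exact: (@cvg_natpowR0 _ C1 _ qz).
  move=> t; apply/andP; split.
    apply: Rintegral_ge0 => om _; by rewrite mulr_ge0 ?powR_ge0 ?sqr_ge0.
  rewrite (bmf_RintegralZ Plt measurableT)// mul1r.
  apply: (@le_trans _ _ ((t + 3)%:R `^ zeta * (C1 * (t + 3)%:R `^ (- q)))).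
    by rewrite ler_wpM2l ?powR_ge0.
  rewrite mulrCA -powR_add ?ltr0n ?addn_gt0 ?orbT//.
  by rewrite (_ : zeta - q = - (q - zeta))// opprB.
Qed.

End convergence_rate.

(** * Choice of the exponents in the two regimes *)

Theorem theorem1 (R : realType) (d : nat)
  (dY : measure_display) (Y : measurableType dY) (P : R.-pker Y ~> Y)
  (dist : probability Y R)
  (dO : measure_display) (Omega : measurableType dO) (Prob : probability Omega R)
  (X : nat -> Omega -> Y)
  (H : 'rV[R]_d -> Y -> 'rV[R]_d) (nrm : 'rV[R]_d -> R) (wstar w0 : 'rV[R]_d)
  (Calpha nu : R) :
  markov_chain Prob P X ->
  (* (A1) unique stationary distribution and uniform geometric mixing *)
  stationary P dist ->
  (forall mu : probability Y R, stationary P mu ->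
     forall A, measurable A -> mu A = dist A) ->
  (exists (CA rho : R), 0 <= rho < 1 /\
     forall (y : Y) (n : nat) (A : set Y), measurable A ->
       (`| kiter P n y A - dist A | <= (CA * rho ^+ n)%:E)%E) ->
  (* H(w, .) is measurable (implicit in the definition of h) *)
  (forall w (i : 'I_d), measurable_fun setT (fun y => H w y 0 i)) ->
  (* (A2) contraction of h in the norm nrm *)
  is_norm nrm ->
  (exists kappa : R, 0 <= kappa < 1 /\
     forall w w', nrm (mean_field dist H w - mean_field dist H w')
                  <= kappa * nrm (w - w')) ->
  (* (A3) Lipschitz in w, uniformly in y, and bounded at 0 *)
  (exists Lh : R, forall w w' y, nrm (H w y - H w' y) <= Lh * nrm (w - w')) ->
  (exists B : R, forall y, nrm (H 0 y) <= B) ->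
  (* w_* is the fixed point of h *)
  mean_field dist H wstar = wstar ->
  0 < Calpha -> 2 / 3 < nu <= 1 ->
  let w := sa_iter H X (lrate Calpha nu) w0 in
  (nu < 1 -> forall zeta : R, 0 < zeta < 3 / 2 * nu - 1 ->
     {ae Prob, forall om, (fun t : nat => (t%:R `^ zeta) * nrm (w t om - wstar) ^+ 2)
                           @ \oo --> 0}) /\
  (nu = 1 -> forall zeta nu1 : R, 0 < zeta < 1 -> 0 < nu1 ->
     {ae Prob, forall om, (fun t : nat =>
        expR (zeta * (ln t%:R) `^ (1 / (1 + nu1))) * nrm (w t om - wstar) ^+ 2)
        @ \oo --> 0}).
Proof.
move=> mc _ _ [CA [rho [/andP[rho0 rho1] mixA]]] mH nrmP [kappa [/andP[kappa0 kappa1] contr]].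
move=> [Lh HL] [B HB] fixp Ca0 /andP[nu23 nu1] w.
have nu0 : 0 < nu by move: nu23; lra.
(* Enlarging the mixing rate makes it positive with negative logarithm, also when [rho = 0]. *)
pose r := Num.max rho 2^-1.
have r0 : 0 < r by rewrite lt_max invr_gt0 ltr0n orbT.
have r1 : r < 1 by rewrite gt_max rho1 invf_lt1// ltr1n.
have mix (y : Y) (n : nat) (A : set Y) : measurable A ->
    (`| kiter P n y A - dist A | <= (`|CA| * r ^+ n)%:E)%E.
  move=> mA; apply: le_trans (mixA y n A mA) _; rewrite lee_fin.
  apply: (@le_trans _ _ (`|CA| * rho ^+ n)).
    by rewrite ler_wpM2r ?ler_norm// exprn_ge0.
  by rewrite ler_wpM2l// lerXn2r ?nnegrE ?(ltW r0)// le_max lexx.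
have HL' w1 w2 y : nrm (H w1 y - H w2 y) <= `|Lh| * nrm (w1 - w2).
  apply: le_trans (HL _ _ _) _; rewrite ler_wpM2r ?ler_norm//; exact: nrm_ge0.
have HB' y : nrm (H 0 y) <= `|B| by apply: le_trans (HB y) (ler_norm _).
have moment q := @moment_rate _ _ _ _ _ _ _ _ _ _ mc _ _ (normr_ge0 CA) r0 r1 mix _ mH _ nrmP
  _ kappa0 kappa1 contr _ (normr_ge0 Lh) HL' _ (normr_ge0 B) HB' _ w0 fixp _ _ Ca0 nu0 nu1 q.
have rate zeta q s := @almost_sure_rate _ _ _ _ _ _ _ _ _ mc _ mH _ nrmP _ (normr_ge0 Lh)
  HL' _ (normr_ge0 B) HB' wstar w0 _ nu Ca0 zeta q s.
split.
  move=> nu_lt1 zeta /andP[z0 z1].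
  (* The midpoint between [2 * (zeta + 1 - nu)] and [nu], an interval that is nonempty exactly when
     [zeta < 3/2 nu - 1]. Lying above the left end means [0 < nu + q / 2 - zeta - 1], and [s] is
     half of this slack. *)
  pose q := (2 * (zeta + 1 - nu) + nu) / 2.
  pose s := (nu + q / 2 - zeta - 1) / 2.
  have q0 : 0 < q by rewrite /q; move: nu1 nu0 z0; lra.
  have qnu : q < nu by rewrite /q; move: z1; lra.
  have s0 : 0 < s by rewrite /s /q; move: z1; lra.
  have mom := moment q (introT andP (conj q0 qnu)) (or_introl nu_lt1).
  have z01 : 0 <= zeta <= 1 by move: z0 z1 nu1; lra.
  have q2 : q / 2 <= nu by move: qnu q0; lra.
  have s1 : s <= nu + q / 2 - zeta - 1 by move: s0; rewrite /s; lra.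
  have s2 : s <= q - zeta by move: s1 nu1 qnu; lra.
  have := rate zeta q s z01 q0 q2 s0 s1 s2 mom; apply: filterS => om.
  apply: (@squeeze_cvg0 _ _ _ 1) => t.
  rewrite mul1r mulr_ge0 ?powR_ge0 ?sqr_ge0//= ler_wpM2r ?sqr_ge0//.
  by apply: ge0_ler_powR; rewrite ?nnegrE ?(ltW z0)// ler_nat leq_addr.
move=> nuE zeta nu2 /andP[z0 z1] nu20.
have k0 : 0 < (1 - kappa) / 2 * Calpha / 2.
  by rewrite !divr_gt0// mulr_gt0// divr_gt0// subr_gt0.
(* The first bound is the size of [q] admissible for [nu = 1], the second ensures [q < nu]. *)
pose q := Num.min ((1 - kappa) / 2 * Calpha / 2) 2^-1.
have q0 : 0 < q by rewrite lt_min k0 invr_gt0 ltr0n.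
have qk : q <= (1 - kappa) / 2 * Calpha / 2 by rewrite ge_min lexx.
have qh : q <= 2^-1 by rewrite ge_min lexx orbT.
have qnu : q < nu by rewrite nuE; move: qh; lra.
have mom := moment q (introT andP (conj q0 qnu)) (or_intror qk).
(* With weight exponent and [s] both equal to [q / 4], the two constraints hold, the first with
   equality; a true power rate follows. *)
pose z := q / 4.
have z'01 : 0 <= z <= 1 by rewrite /z; move: q0 qh; lra.
have z'0 : 0 < z by rewrite /z divr_gt0.
have q2 : q / 2 <= nu by rewrite nuE; move: qh; lra.
have s1 : q / 4 <= nu + q / 2 - z - 1 by rewrite nuE /z; lra.
have s2 : q / 4 <= q - z by rewrite /z; move: q0; lra.
have b01 : 0 < 1 / (1 + nu2) < 1.
  have n1 : 0 < 1 + nu2 by rewrite addr_gt0.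
  by rewrite divr_gt0//= ltr_pdivrMr// mul1r ltrDl.
(* As [zeta < 1], this bounds the exponential weight by [expR K] times [(t + 3) ^ z]. *)
have [K K0 hK] := powR_le_linear b01 z'0.
have := rate z q (q / 4) z'01 q0 q2 z'0 s1 s2 mom; apply: filterS => om.
apply: (@squeeze_cvg0 _ _ _ (expR K)) => t.
rewrite mulr_ge0 ?expR_ge0 ?sqr_ge0//= mulrA ler_wpM2r ?sqr_ge0//.
have n3 : 0 < (t + 3)%:R :> R by rewrite ltr0n addn_gt0 orbT.
rewrite (powR_expR z n3) -expRD ler_expR.
(* At [t = 0] the convention [ln 0 = 0] applies. *)
have lnt : 0 <= ln (t%:R : R).
  by case: t {n3} => [|t]; [rewrite ln0|rewrite ln_ge0// ler1n].
have lnt3 : ln (t%:R : R) <= ln (t + 3)%:R.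
  case: t lnt n3 => [|t] lnt n3; first by rewrite [leLHS]ln0// ln_ge0// ler1n.
  by rewrite ler_ln ?posrE ?ltr0n// ler_nat leq_addr.
apply: (@le_trans _ _ (ln (t%:R : R) `^ (1 / (1 + nu2)))).
  by rewrite ler_piMl ?powR_ge0// ltW.
apply: le_trans (hK _ lnt) _; rewrite addrC lerD2l ler_wpM2l//; exact: ltW.
Qed.
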